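(* Let $L>0$, $T>0$, $\mu>0$, $\ell>1/2$ and $\tau_P=\frac{L^2}{2\pi}$. Then $a\in C^0([0,T];H^\ell_{\mathrm{per}}(0,L))$ is a mild solution to the nonlocal amplitude equation $$\partial_t a=\partial_x^2\Big[-\mu a-\partial_x^2a+\tfrac32\big(2a\langle|a|^2\rangle-\mathcal{F}^{-1}[\hat a|\hat a|^2]\big)\Big]$$ if and only if there is a pair $(v,w)\in C^0([0,T]\times[0,\tau_P];H^\ell_{\mathrm{per}}(0,L)\times H^\ell_{\mathrm{per}}(0,L))$ such that the triple $(a,v,w)$ is a mild solution to the extended local problem $$\partial_t a=\partial_x^2\Big[-\mu a-\partial_x^2a+\tfrac{3}{2\tau_P}w(t,\tau_P)\Big],\qquad \partial_\tau v=i\,\partial_x^2v,\qquad \partial_\tau w=i\,\partial_x^2w+v|v|^2$$ with $(v,w)(t,0)=(a(t),0)$ for $t\in[0,T]$.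
   Context: For $\ell>1/2$, $H^\ell_{\mathrm{per}}(0,L)$ is the Sobolev space of complex-valued periodic functions $u(x)=\sum_{K\in\mathbb{Z}}\hat u_K e^{2\pi i Kx/L}$ on $(0,L)$, with norm $\|u\|_{H^\ell_{\mathrm{per}}}=C\big(\sum_{K\in\mathbb{Z}}(1+|K|^2)^\ell|\hat u_K|^2\big)^{1/2}$, where the constant $C>0$ is fixed large enough that the norm is submultiplicative and $\|u\|_{L^\infty(0,L)}\le\|u\|_{H^\ell_{\mathrm{per}}}$. $\langle|a|^2\rangle=\sum_{K\in\mathbb{Z}}|\hat a_K|^2$ is the spatial average, and $\mathcal{F}^{-1}[\hat a|\hat a|^2]$ is the function with Fourier coefficients $\hat a_K|\hat a_K|^2$, $K\in\mathbb{Z}$. Write $\mathcal{N}(a)=2a\langle|a|^2\rangle-\mathcal{F}^{-1}[\hat a|\hat a|^2]$. Let $\mathcal{L}=-\partial_x^4-\mu\partial_x^2$ with domain $H^{\ell+4}_{\mathrm{per}}(0,L)$; it generates an analytic semigroup $e^{t\mathcal{L}}$ on $H^\ell_{\mathrm{per}}(0,L)$, and for $t>0$ let $B_2(t)$ denote the bounded extension to $H^\ell_{\mathrm{per}}(0,L)$ of $e^{t\mathcal{L}}\partial_x^2$, initially defined on $H^{\ell+2}_{\mathrm{per}}(0,L)$. Let $S_\tau=e^{i\tau\partial_x^2}$ be the Schrödinger group, $S_\tau u=\sum_{K\in\mathbb{Z}}e^{-i\tau(2\pi K/L)^2}\hat u_K e^{2\pi iKx/L}$, which is $\tau_P$-periodic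 in $\tau$. A mild solution of the nonlocal amplitude equation is $a\in C^0([0,T];H^\ell_{\mathrm{per}}(0,L))$ with $a(t)=e^{t\mathcal{L}}a(0)+\tfrac32\int_0^tB_2(t-s)\,\mathcal{N}(a(s))\,ds$ for $t\in[0,T]$. A mild solution of the extended local problem with $(v,w)(t,0)=(a(t),0)$ is a triple $(a,v,w)$ such that for all $t\in[0,T]$, $\tau\in[0,\tau_P]$: $a(t)=e^{t\mathcal{L}}a(0)+\tfrac{3}{2\tau_P}\int_0^tB_2(t-s)\,w(s,\tau_P)\,ds$, $v(t,\tau)=S_\tau a(t)$, and $w(t,\tau)=\int_0^\tau S_{\tau-s}\big(v(t,s)|v(t,s)|^2\big)\,ds$. Integrals are Bochner integrals in $H^\ell_{\mathrm{per}}(0,L)$. *)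

(* Defs.v *)
From HB Require Import structures.
From mathcomp Require Import all_boot all_order all_algebra.
From mathcomp Require Import complex ring lra.
From mathcomp Require Import all_classical all_reals all_analysis.

Set Implicit Arguments.
Unset Strict Implicit.
Unset Printing Implicit Defensive.

Import Order.TTheory GRing.Theory Num.Theory.
Import numFieldNormedType.Exports.

Local Open Scope classical_set_scope.
Local Open Scope ring_scope.

(* [Rcomplex R] is R[i] with its real-valued modulus and its structure of
   R-vector space. *)

Lemma RcomplexZ_norm (R : rcfType) (x : R) (z : Rcomplex R) :
  `|x *: z| = `|x| * `|z|.
Proof.
rewrite /Num.norm /=; case: z => p q /=.
by rewrite !exprMn -mulrDr sqrtrM ?sqr_ge0// sqrtr_sqr.
Qed.

Definition cis (R : realType) (x : R) : Rcomplex R := Complex (cos x) (sin x).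

Section sobolev_energy.
Context {R : realType}.
Implicit Types (l : R) (c d : int -> Rcomplex R).

(* The squared H^l-norm of a family of Fourier coefficients. *)
Definition energy l c : \bar R :=
  \esum_(K in [set: int]) ((1 + K%:~R ^+ 2) `^ l * `|c K| ^+ 2)%:E.

Definition finite_energy l : {pred int -> Rcomplex R} :=
  fun c => (energy l c < +oo)%E.

Lemma energy_ge0 l c : (0 <= energy l c)%E.
Proof.
by apply: esum_ge0 => K _; rewrite lee_fin mulr_ge0 ?powR_ge0 ?sqr_ge0.
Qed.

Lemma energy0 l : energy l 0 = 0%E.
Proof. by rewrite /energy esum1// => K _; rewrite normr0 expr0n mulr0. Qed.

Lemma esumZ_le (x : R) (f : int -> R) : 0 <= x -> (forall K, 0 <= f K) ->
  (\esum_(K in [set: int]) (x * f K)%:E <=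
   x%:E * \esum_(K in [set: int]) (f K)%:E)%E.
Proof.
move=> x0 f0; apply: ge_ereal_sup => _ /= [A [finA _] <-].
under eq_fsbigr do rewrite EFinM.
rewrite -ge0_mule_fsumr; last by move=> K; rewrite lee_fin.
by rewrite lee_wpmul2l ?lee_fin//; apply: ereal_sup_ubound; exists A.
Qed.

Let weighted_ge0 l c K : 0 <= (1 + K%:~R ^+ 2) `^ l * `|c K| ^+ 2.
Proof. by rewrite mulr_ge0 ?powR_ge0 ?sqr_ge0. Qed.

Lemma energyZ_le l (x : R) c : (energy l (x *: c) <= (x ^+ 2)%:E * energy l c)%E.
Proof.
apply: le_trans (esumZ_le (sqr_ge0 x) (weighted_ge0 l c)).
apply: le_esum => K _; rewrite lee_fin.
have -> : (x *: c) K = x *: c K by [].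
by rewrite RcomplexZ_norm exprMn real_normK ?num_real// mulrCA.
Qed.

Lemma energyZ l (x : R) c : energy l (x *: c) = ((x ^+ 2)%:E * energy l c)%E.
Proof.
apply/eqP; rewrite eq_le energyZ_le/=.
have [->|x0] := eqVneq x 0.
  by rewrite expr0n/= mul0e energy_ge0.
have /(lee_wpmul2l (x := (x ^+ 2)%:E)) := energyZ_le l x^-1 (x *: c).
rewrite lee_fin sqr_ge0 scalerA mulVf// scale1r muleA -EFinM => /(_ isT).
by rewrite -exprMn mulfV// expr1n mul1e.
Qed.

Lemma energyD_le l (t : R) c d : 0 < t ->
  (energy l (c + d)%R <= (1 + t)%:E * energy l c + (1 + t^-1)%:E * energy l d)%E.
Proof.
move=> t0; have tV0 : 0 < t^-1 by rewrite invr_gt0.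
have t1 : 0 <= 1 + t by rewrite addr_ge0 ?ltW.
have tV1 : 0 <= 1 + t^-1 by rewrite addr_ge0 ?ltW.
apply: le_trans (leeD (esumZ_le t1 (weighted_ge0 l c))
                      (esumZ_le tV1 (weighted_ge0 l d))).
rewrite -esumD => [|K _|K _]; rewrite ?lee_fin ?mulr_ge0 ?powR_ge0 ?sqr_ge0//.
apply: le_esum => K _; rewrite -EFinD lee_fin.
have -> : (c + d) K = c K + d K by [].
rewrite (mulrCA (1 + t)) (mulrCA (1 + t^-1)) -mulrDr ler_wpM2l ?powR_ge0//.
set p := `|c K|; set q := `|d K|.
apply: (@le_trans _ _ ((p + q) ^+ 2)).
  rewrite lerXn2r ?nnegrE ?addr_ge0 ?normr_ge0//; exact: ler_normD.
have : 0 <= (t * p - q) ^+ 2 * t^-1 by rewrite mulr_ge0 ?sqr_ge0 ?ltW.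
have -> : (t * p - q) ^+ 2 * t^-1 = t * p ^+ 2 + t^-1 * q ^+ 2 - 2 * (p * q).
  by field; rewrite gt_eqF.
by rewrite !mulrDl !mul1r; nra.
Qed.

Lemma energy_eq0 l c : energy l c = 0%E -> c = 0.
Proof.
move=> c0; apply/funext => K; apply/eqP; rewrite -normr_eq0.
have : (((1 + K%:~R ^+ 2) `^ l * `|c K| ^+ 2)%:E <= 0 :> \bar R)%E.
  rewrite -c0; apply: esum_ge; exists [set K]; first by split.
  by rewrite fsbig_set1.
rewrite lee_fin pmulr_rle0; last by rewrite powR_gt0// ltr_pwDl ?sqr_ge0.
by rewrite -sqrf_eq0 eq_le sqr_ge0 andbT.
Qed.

Lemma finite_energy_submod l : submod_closed (finite_energy l).
Proof.
split; first by rewrite unfold_in energy0.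
move=> x c d; rewrite !unfold_in => cl dl.
apply: le_lt_trans (energyD_le _ _ _ (@ltr01 R)) _.
rewrite lte_add_pinfty// lte_mul_pinfty ?lee_fin ?energy_ge0// energyZ.
by rewrite lte_mul_pinfty ?lee_fin ?sqr_ge0.
Qed.

HB.instance Definition _ l := GRing.isSubmodClosed.Build R (int -> Rcomplex R)
  (finite_energy l) (finite_energy_submod l).

End sobolev_energy.

(* The space H^l_per(0, L), an element being given by its family of Fourier
   coefficients; [L] enters through the coercion to functions below, and [C] is
   the constant factor of the norm. *)
Record Hper (R : realType) (L l : R) (C : {posnum R}) := MkHper {
  coef : int -> Rcomplex R;
  coefP : coef \in finite_energy l
}.

Section Hper_normed.
Context (R : realType) (L l : R) (C : {posnum R}).
Local Notation H := (Hper L l C).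

HB.instance Definition _ := [isSub for (@coef R L l C)].
HB.instance Definition _ := [Choice of H by <:].
HB.instance Definition _ := [SubChoice_isSubLmodule of H by <:].

Definition Hnorm (u : H) : R := C%:num * Num.sqrt (fine (energy l (coef u))).

Lemma coef_fin_num (u : H) : energy l (coef u) \is a fin_num.
Proof.
by rewrite ge0_fin_numE ?energy_ge0//; have := coefP u; rewrite unfold_in.
Qed.

Lemma HnormZ (x : R) (u : H) : Hnorm (x *: u) = `|x| * Hnorm u.
Proof.
rewrite /Hnorm -[coef (x *: u)]/(x *: coef u) energyZ fineM ?coef_fin_num//=.
by rewrite sqrtrM ?sqr_ge0// sqrtr_sqr mulrCA.
Qed.

Lemma Hnorm_eq0 (u : H) : Hnorm u = 0 -> u = 0.
Proof.
move/eqP; rewrite mulf_eq0 gt_eqF//= sqrtr_eq0 => u0.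
apply: val_inj => /=; apply: (@energy_eq0 _ l).
rewrite -(fineK (coef_fin_num u)); congr EFin; apply/eqP.
by rewrite eq_le u0 fine_ge0 ?energy_ge0.
Qed.

Lemma Hnorm0 : Hnorm 0 = 0.
Proof. by rewrite /Hnorm -[coef 0]/0 energy0 sqrtr0 mulr0. Qed.

Lemma HnormD (u v : H) : Hnorm (u + v) <= Hnorm u + Hnorm v.
Proof.
have Hge0 w : 0 <= Hnorm w by rewrite mulr_ge0 ?sqrtr_ge0.
have [/eqP u0|u0] := boolP (Hnorm u == 0).
  by rewrite u0 add0r (Hnorm_eq0 u0) add0r.
have [/eqP v0|v0] := boolP (Hnorm v == 0).
  by rewrite v0 addr0 (Hnorm_eq0 v0) addr0.
rewrite -mulrDr ler_pM2l//.
set A := Num.sqrt (fine (energy l (coef u))).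
set B := Num.sqrt (fine (energy l (coef v))).
have A0 : 0 < A.
  rewrite lt_neqAle sqrtr_ge0 andbT eq_sym.
  by apply: contra u0; rewrite /Hnorm -/A => /eqP ->; rewrite mulr0.
have B0 : 0 < B.
  rewrite lt_neqAle sqrtr_ge0 andbT eq_sym.
  by apply: contra v0; rewrite /Hnorm -/B => /eqP ->; rewrite mulr0.
have EA : energy l (coef u) = (A ^+ 2)%:E.
  by rewrite sqr_sqrtr ?fine_ge0 ?energy_ge0// fineK ?coef_fin_num.
have EB : energy l (coef v) = (B ^+ 2)%:E.
  by rewrite sqr_sqrtr ?fine_ge0 ?energy_ge0// fineK ?coef_fin_num.
rewrite -(ger0_norm (addr_ge0 (ltW A0) (ltW B0))) -(sqrtr_sqr (A + B)).
apply: ler_wsqrtr.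
rewrite -lee_fin fineK ?coef_fin_num//.
apply: le_trans (energyD_le _ _ _ (divr_gt0 B0 A0)) _.
rewrite EA EB -!EFinM -EFinD lee_fin le_eqVlt; apply/orP; left; apply/eqP.
by field; rewrite !gt_eqF.
Qed.

HB.instance Definition _ :=
  Lmodule_isNormed.Build R H HnormD HnormZ Hnorm_eq0.

End Hper_normed.
(* The sum over all integers, as the limit of the symmetric partial sums. *)
Definition zseries (R : realType) (f : int -> Rcomplex R) : Rcomplex R :=
  let S N := \sum_(0 <= k < N.*2.+1) f (k%:Z - N%:Z) in
  Complex (limn (fun N => complex.Re (S N))) (limn (fun N => complex.Im (S N))).

(* The function with the given Fourier coefficients; for l > 1/2 the series
   converges absolutely. *)
Definition Heval (R : realType) (L l : R) (C : {posnum R}) (u : Hper L l C)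
    (x : R) : Rcomplex R :=
  zseries (fun K => coef u K * cis (2 * pi * K%:~R * x / L)).

Coercion Heval : Hper >-> Funclass.

Section Hper_operators.
Context {R : realType} {L l : R} {C : {posnum R}}.
Local Notation H := (Hper L l C).
Implicit Types (u v w a f : H).

(* [0] is a default value for families of infinite H^l-energy. *)
Definition Finv (c : int -> Rcomplex R) : H := insubd 0 c.

Definition wavenumber (K : int) : R := 2 * pi * K%:~R / L.

(* H^(l+m)_per as a subset of H^l_per; [dx] is meaningful on [sobolev 1]. *)
Definition sobolev (m : R) : set H := [set u | (energy (l + m) (coef u) < +oo)%E].

Definition dx u : H := Finv (fun K => Complex 0 (wavenumber K) * coef u K).

Definition Lop (mu : R) u : H := - iter 4 dx u - mu *: iter 2 dx u.

Definition schroedinger (tau : R) u : H :=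
  Finv (fun K => cis (- (tau * wavenumber K ^+ 2)) * coef u K).

Definition avg_sq u : R := fine (\esum_(K in [set: int]) (`|coef u K| ^+ 2)%:E).

Definition nonlocal a : H :=
  (2 * avg_sq a) *: a - Finv (fun K => `|coef a K| ^+ 2 *: coef a K).

(* The element of H^l_per representing the pointwise product v |v|^2; it exists
   since H^l_per is an algebra for l > 1/2. *)
Definition cubic v : H := xget 0 [set w : H | forall x, w x = `|v x| ^+ 2 *: v x].

End Hper_operators.

(* The norm is submultiplicative and dominates the sup norm; for l > 1/2 this
   holds as soon as [C] is large enough. *)
Definition admissible_norm (R : realType) (L l : R) (C : {posnum R}) : Prop :=
  (forall u v w : Hper L l C,
     (forall x, w x = u x * v x) -> `|w| <= `|u| * `|v|) /\
  (forall (u : Hper L l C) x, 0 < x < L -> `|u x| <= `|u|).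

Section semigroups.
Context {R : realType} {V : normedModType R}.
Implicit Types (E : R -> V -> V) (A : V -> V) (D : set V).

Definition bounded_linear (F : V -> V) : Prop :=
  linear F /\ exists M : R, forall u, `|F u| <= M * `|u|.

Definition C0_semigroup E : Prop :=
  [/\ forall t, 0 <= t -> bounded_linear (E t),
      forall u, E 0 u = u,
      forall s t u, 0 <= s -> 0 <= t -> E (s + t) u = E s (E t u) &
      forall u, E t u @[t --> 0^'+] --> u].

(* The operator [A] with domain [D] is the infinitesimal generator of [E]. *)
Definition generates A D E : Prop :=
  C0_semigroup E /\
  forall u f, (h^-1 *: (E h u - u)) @[h --> 0^'+] --> f <-> D u /\ f = A u.

End semigroups.

Section Bochner.
Context d (T : measurableType d) (R : realType) (V : normedModType R).
Variables (mu : {measure set T -> \bar R}) (D : set T).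
Implicit Types (s f : T -> V).

Definition bochner_simple s : Prop :=
  [/\ finite_set (range s),
      forall y, measurable (s @^-1` [set y]) &
      forall y, y != 0 -> (mu (D `&` s @^-1` [set y]) < +oo)%E].

Definition bochner_simple_integral s : V :=
  \sum_(y \in range s) fine (mu (D `&` s @^-1` [set y])) *: y.

(* [f] is Bochner integrable on [D], with integral [I]. *)
Definition is_bochner f (I : V) : Prop :=
  exists s : nat -> T -> V,
    [/\ forall n, bochner_simple (s n),
        {ae mu, forall x, D x -> s ^~ x @ \oo --> f x},
        (\int[mu]_(x in D) (`|f x - s n x|)%:E)%E @[n --> \oo] --> (0 : \bar R) &
        bochner_simple_integral (s n) @[n --> \oo] --> I].

End Bochner.

Section amplitude_equations.
Context {R : realType} {L l : R} {C : {posnum R}}.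
Local Notation H := (Hper L l C).
Implicit Types (E B : R -> H -> H) (a : R -> H) (v w : R -> R -> H).

(* For t > 0, [B t] is the bounded extension of [E t \o dx \o dx]; [B 0] is not
   constrained, and enters the equations below only on a null set. *)
Definition bounded_extension2 E B : Prop :=
  forall t, 0 < t ->
    bounded_linear (B t) /\
    forall u, sobolev 2 u -> B t u = E t (iter 2 dx u).

Definition mild_nonlocal (T : R) E B a : Prop :=
  {within `[0, T], continuous a} /\
  forall t, t \in `[0, T] ->
    exists2 I : H,
      is_bochner lebesgue_measure `[0, t] (fun s => B (t - s) (nonlocal (a s))) I &
      a t = E t (a 0) + (3 / 2) *: I.

Definition mild_extended (T tauP : R) E B a v w : Prop :=
  forall t, t \in `[0, T] ->
    (exists2 I : H,
       is_bochner lebesgue_measure `[0, t] (fun s => B (t - s) (w s tauP)) I &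
       a t = E t (a 0) + (3 / (2 * tauP)) *: I) /\
    forall tau, tau \in `[0, tauP] ->
      v t tau = schroedinger tau (a t) /\
      is_bochner lebesgue_measure `[0, tau]
        (fun s => schroedinger (tau - s) (cubic (v t s))) (w t tau).

End amplitude_equations.

(* Main.v *)
Require Import Defs.
From mathcomp Require Import all_boot all_order all_algebra.
From mathcomp Require Import complex ring lra zify.
From mathcomp Require Import all_classical all_reals all_analysis.
From mathcomp Require Import measurable_realfun.
Import Order.TTheory GRing.Theory Num.Theory.
Import numFieldNormedType.Exports.
Local Open Scope classical_set_scope.
Local Open Scope ring_scope.

(* The phase of [S_tau] at tau = tauP is exp(- 2 pi i K^2) = 1, and the cubic
   term of modes K1, K2, K3 (the last one conjugated) contributes to
   [w(t, tauP)] the average over one period of exp(i s k^2 m) with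
   m = (K1 + K2 - K3)^2 - K1^2 - K2^2 + K3^2 = 2 (K1 - K3) (K2 - K3).  Only the
   resonances K1 = K3 or K2 = K3 survive, whence w(t, tauP) = tauP N(a(t)), and
   the two integral equations for [a] coincide.

   The Bochner integrals are limits of Riemann sums: for a trigonometric
   polynomial the sum over n + 1 equidistant nodes of a period is exact as soon
   as n exceeds every |m|, and both sides depend continuously on [a], uniformly
   in the number of nodes.  The algebra property of H^l and the summability of
   Fourier coefficients both follow from the two bounds in [admissible_norm], by
   density and translation. *)

Set Implicit Arguments.
Unset Strict Implicit.
Unset Printing Implicit Defensive.

(** * Bochner integrals of uniformly continuous functions *)

Section bochner_simple.
Context d (T : measurableType d) (R : realType) (V : normedModType R).
Context (mu : {measure set T -> \bar R}) (D : set T).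
Hypotheses (mD : measurable D) (muD : (mu D < +oo)%E).
Implicit Types s : T -> V.

Lemma measureI_fin_num (A : set T) : measurable A -> mu (D `&` A) \is a fin_num.
Proof.
move=> mA; rewrite ge0_fin_numE//; apply: le_lt_trans muD.
by apply: le_measure; rewrite ?inE//; exact: measurableI.
Qed.

Section index.
Context (I : finType) (k : T -> I).
Hypothesis mk : forall i, measurable (k @^-1` [set i]).
Let mDk i : measurable (D `&` k @^-1` [set i]).
Proof. exact: measurableI. Qed.

Lemma measurable_fiber (F : I -> V) (y : V) :
  measurable ((F \o k) @^-1` [set y]).
Proof.
rewrite (_ : _ @^-1` _ = \bigcup_(i in [set i | F i = y]) (k @^-1` [set i])).
  by apply: fin_bigcup_measurable => //; exact: finite_finset.
apply/seteqP; split => [x Fy|x [i /= Fi ki]]; first by exists (k x).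
by rewrite /= ki.
Qed.

Lemma measure_fiber (F : I -> V) (y : V) :
  fine (mu (D `&` (F \o k) @^-1` [set y])) =
  \sum_(i | F i == y) fine (mu (D `&` k @^-1` [set i])).
Proof.
have -> : D `&` (F \o k) @^-1` [set y] =
    \bigcup_(i in [set` [seq i <- index_enum I | F i == y]])
      (D `&` k @^-1` [set i]).
  apply/seteqP; split => [x [Dx Fy]|x [i /=]].
    by exists (k x) => //=; rewrite mem_filter mem_index_enum andbT; exact/eqP.
  by rewrite mem_filter => /andP[/eqP Fi _] [Dx ki]; split => //=; rewrite ki.
rewrite measure_fin_bigcup//; last first.
  by move=> i j _ _ [x [[_ <-] [_ <-]]].
rewrite -fsbig_seq ?filter_uniq ?index_enum_uniq// big_filter.
by rewrite sum_fine// => i _; exact: measureI_fin_num.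
Qed.

Lemma bochner_simple_integral_index (F : I -> V) :
  bochner_simple_integral mu D (F \o k) =
  \sum_i fine (mu (D `&` k @^-1` [set i])) *: F i.
Proof.
rewrite /bochner_simple_integral.
rewrite (fsbig_fwiden (undup (codom F))) ?undup_uniq//; first last.
- move=> y [_ /= ynk]; rewrite (_ : D `&` _ = set0).
    by rewrite measure0 /= scale0r.
  by apply/seteqP; split => // x [_ sx]; apply: ynk; exists x.
- by move=> _ [x _ <-] /=; rewrite mem_undup codom_f.
under eq_bigr => y _ do (rewrite (measure_fiber F y) scaler_suml).
rewrite (exchange_big_dep predT)//=; apply: eq_bigr => i _.
rewrite -big_filter (_ : [seq y <- _ | _] = [:: F i]) ?big_seq1//.
rewrite (eq_filter (a2 := pred1 (F i))) => [|y]; last by rewrite /= eq_sym.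
by rewrite filter_pred1_uniq ?undup_uniq ?mem_undup ?codom_f.
Qed.

Lemma integral_norm_index (F : I -> V) :
  (\int[mu]_(x in D) (`|F (k x)|)%:E =
   (\sum_i fine (mu (D `&` k @^-1` [set i])) * `|F i|)%:E)%E.
Proof.
have FE x : (`|F (k x)|)%:E =
    (\sum_i (`|F i|%:E * (\1_(k @^-1` [set i]) x)%:E))%E.
  rewrite (bigD1 (k x))//= big1 ?adde0 => [|i ix].
    by rewrite indicE mem_set// mule1.
  by rewrite indicE memNset ?mule0// => kx; rewrite -kx eqxx in ix.
under eq_integral do rewrite FE.
have mind i : measurable_fun D (EFin \o (\1_(k @^-1` [set i]) : T -> R)).
  by apply/measurable_EFinP; exact: measurable_indic.
rewrite ge0_integral_sum// => [|i]; last first.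
  by apply: measurable_funeM; exact: mind.
rewrite -sumEFin; apply: eq_bigr => i _.
rewrite ge0_integralZl_EFin//; last exact: mind.
rewrite integral_indic//.
by rewrite setIC EFinM muleC fineK// measureI_fin_num.
Qed.

Lemma bochner_simple_index (F : I -> V) : bochner_simple mu D (F \o k).
Proof.
split.
- apply: (@sub_finite_set _ _ [set` codom F]); last exact: finite_seq.
  by move=> _ [x _ <-] /=; exact: codom_f.
- exact: measurable_fiber.
- move=> y _; apply: le_lt_trans muD.
  apply: le_measure; rewrite ?inE//.
  by apply: measurableI => //; apply: measurable_fiber.
Qed.
End index.

Lemma bochner_simple_factor s : bochner_simple mu D s ->
  exists (I : finType) (k : T -> I) (F : I -> V),
    s = F \o k /\ forall i, measurable (k @^-1` [set i]).
Proof.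
move=> [/finite_seqP[r rE] ms _].
have sr x : s x \in r.
  by have : range s (s x) by [exists x]; rewrite rE.
exists (seq_sub r), (fun x => SeqSub (sr x)), (@ssval _ r); split => // i.
rewrite (_ : _ @^-1` _ = s @^-1` [set ssval i])//.
apply/seteqP; split => x /=; first by move=> <-.
by move=> sx; apply: val_inj.
Qed.

Lemma dist_bochner_simple_integral s1 s2 :
  bochner_simple mu D s1 -> bochner_simple mu D s2 ->
  ((`|bochner_simple_integral mu D s1 - bochner_simple_integral mu D s2|)%:E <=
   \int[mu]_(x in D) (`|s1 x - s2 x|)%:E)%E.
Proof.
move=> /bochner_simple_factor[I [k [F [-> mk]]]].
move=> /bochner_simple_factor[J [h [G [-> mh]]]].
pose kh x := (k x, h x).
have mkh ij : measurable (kh @^-1` [set ij]).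
  rewrite (_ : _ @^-1` _ = k @^-1` [set ij.1] `&` h @^-1` [set ij.2]).
    exact: measurableI.
  apply/seteqP; split => x /= => [<-//|[k1 h2]].
  by rewrite /kh k1 h2 -surjective_pairing.
rewrite -[F \o k]/((F \o fst) \o kh) -[G \o h]/((G \o snd) \o kh).
rewrite !bochner_simple_integral_index//.
rewrite (integral_norm_index mkh (fun ij => F ij.1 - G ij.2)) lee_fin.
rewrite -sumrB; apply: le_trans (ler_norm_sum _ _ _) _.
by apply: ler_sum => ij _; rewrite -scalerBr normrZ ger0_norm.
Qed.
End bochner_simple.

Section bochner_integral.
Context d (T : measurableType d) (R : realType) (V : normedModType R).
Context (mu : {measure set T -> \bar R}) (D : set T).
Hypothesis mD : measurable D.

Import HBNNSimple.

(* No measurability is assumed: for nonnegative functions [\int] is the lower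
   integral, so every simple minorant of [g] yields, up to the null set [N], a
   simple minorant of [f]. *)
Lemma ge0_integral_le_scale (N : set T) (c : R) (f g : T -> R) :
  measurable N -> mu N = 0 -> 0 < c -> (forall x, 0 <= f x) ->
  (forall x, 0 <= g x) -> (forall x, D x -> ~ N x -> g x <= c * f x) ->
  (\int[mu]_(x in D) (g x)%:E <= c%:E * \int[mu]_(x in D) (f x)%:E)%E.
Proof.
move=> mN N0 c0 f0 g0 gf.
rewrite [leLHS]ge0_integralE => [|x _]; last by rewrite lee_fin.
rewrite [in leRHS]ge0_integralE => [|x _]; last by rewrite lee_fin.
apply: ge_ereal_sup => _ /= [h hg <-].
have cV0 : 0 <= c^-1 by rewrite invr_ge0 ltW.
pose h1 := proj_nnsfun h (measurableC mN).
pose h2 := scale_nnsfun h1 cV0.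
have hh1 : sintegral mu h = sintegral mu h1.
  rewrite -!integralT_nnsfun; apply: ae_eq_integral => //.
  - exact/measurable_EFinP.
  - exact/measurable_EFinP.
  exists N; split => // x /= hx; apply: contrapT => Nx; apply: hx => _.
  by rewrite /= /mindic indicE mem_set// mulr1.
rewrite hh1 (_ : sintegral mu h1 = (c%:E * sintegral mu h2)%E); last first.
  by rewrite sintegralrM muleA -EFinM mulfV ?gt_eqF// mul1e.
rewrite lee_pmul2l//; apply: ereal_sup_ubound; exists h2 => //= x.
rewrite /mindic indicE; have := hg x; rewrite /patch.
case: ifPn => xD; rewrite !lee_fin => hgx.
  have [Nx|Nx] := pselect (N x).
    by rewrite memNset ?mulr0//; exact.
  rewrite mem_set// mulr1 mulrC ler_pdivrMr// mulrC.
  by apply: le_trans hgx _; apply: gf => //; exact: set_mem.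
have -> : h x = 0 by apply/eqP; rewrite eq_le hgx fun_ge0.
by rewrite mul0r mulr0.
Qed.

Lemma is_bochner_scale_ae (muD : (mu D < +oo)%E) (N : set T) (c : R)
    (f g : T -> V) (I : V) :
  measurable N -> mu N = 0 -> c != 0 ->
  (forall x, D x -> ~ N x -> g x = c *: f x) ->
  is_bochner mu D f I -> is_bochner mu D g (c *: I).
Proof.
move=> mN N0 c0 gf [s [simple_s s_cvg int_s intI]].
exists (fun n x => c *: s n x); split.
- move=> n; have [I0 [k [F [-> mk]]]] := bochner_simple_factor (simple_s n).
  exact: (bochner_simple_index mD muD mk (fun i => c *: F i)).
- have : {ae mu, forall x, ~ N x}.
    by exists N; split => // x /=; apply: contrapT.
  apply: filterS2 s_cvg => x sx Nx Dx; rewrite gf//.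
  by apply: cvgZr; exact: sx.
- have cint : (`|c|%:E * \int[mu]_(x in D) (`|f x - s n x|)%:E)%E
      @[n --> \oo] --> (0 : \bar R).
    rewrite -(mule0 `|c|%:E); apply: cvgeMl => //.
  apply: (squeeze_cvge _ (cvg_cst (0 : \bar R)) cint).
  apply: nearW => n; rewrite integral_ge0 => [/=|x _]; last by rewrite lee_fin.
  apply: (@ge0_integral_le_scale N) => //; first by rewrite normr_gt0.
  by move=> x Dx Nx; rewrite gf// -scalerBr normrZ.
- rewrite (_ : (fun n => _) =
      (fun n => c *: bochner_simple_integral mu D (s n))).
    exact: cvgZr.
  apply/funext => n.
  have [I0 [k [F [-> mk]]]] := bochner_simple_factor (simple_s n).
  rewrite [RHS](congr1 _ (bochner_simple_integral_index mD muD mk F)).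
  rewrite (bochner_simple_integral_index mD muD mk (fun i => c *: F i)).
  by rewrite scaler_sumr; apply: eq_bigr => i _; rewrite scalerA mulrC -scalerA.
Qed.

Lemma eq_is_bochner (muD : (mu D < +oo)%E) (f g : T -> V) (I : V) :
  (forall x, D x -> f x = g x) -> is_bochner mu D f I -> is_bochner mu D g I.
Proof.
move=> fg fI; rewrite -(scale1r I).
apply: (is_bochner_scale_ae muD _ _ _ _ fI (N := set0)) => //.
by move=> x Dx _; rewrite scale1r fg.
Qed.
End bochner_integral.

Section seq_limits.
Context (R : realType) (V : normedModType R).
Implicit Types u : nat -> V.

Lemma cvg_seqP u (x : V) : u n @[n --> \oo] --> x <->
  forall e, 0 < e -> exists N, forall n, (N <= n)%N -> `|u n - x| <= e.
Proof.
split=> [/cvgrPdist_le ux e e0|ux].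
  by have [N _ uN] := ux e e0; exists N => n Nn; rewrite distrC; exact: uN.
apply/cvgrPdist_le => e e0; have [N uN] := ux e e0.
by exists N => // n /= Nn; rewrite distrC; exact: uN.
Qed.

Definition seq_complete := forall u,
  (forall e, 0 < e -> exists N, forall m n, (N <= m)%N -> (N <= n)%N ->
    `|u m - u n| <= e) ->
  exists x : V, u n @[n --> \oo] --> x.

End seq_limits.

Section uniform_limit.
Context d (T : measurableType d) (R : realType) (V : normedModType R).
Context (mu : {measure set T -> \bar R}) (D : set T).
Hypotheses (mD : measurable D) (muD : (mu D < +oo)%E).

Lemma measurable_dist (g r : T -> V) :
  (forall y, measurable_fun D (fun x => `|g x - y|)) -> bochner_simple mu D r ->
  measurable_fun D (fun x => `|g x - r x|).
Proof.
move=> mg /bochner_simple_factor[I [k [F [-> mk]]]].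
have -> : (fun x => `|g x - (F \o k) x|) =
    (fun x => \sum_i \1_(k @^-1` [set i]) x * `|g x - F i|).
  apply/funext => x; rewrite (bigD1 (k x))//= big1 ?addr0 => [|i ix].
    by rewrite indicE mem_set// mul1r.
  by rewrite indicE memNset ?mul0r// => kx; rewrite -kx eqxx in ix.
by apply: measurable_sum => i; exact: measurable_funM.
Qed.

Lemma dist_bochner_simple_integral_le (f r1 r2 : T -> V) :
  (forall y, measurable_fun D (fun x => `|f x - y|)) ->
  bochner_simple mu D r1 -> bochner_simple mu D r2 ->
  ((`|bochner_simple_integral mu D r1 - bochner_simple_integral mu D r2|)%:E
   <= \int[mu]_(x in D) (`|f x - r1 x|)%:E +
      \int[mu]_(x in D) (`|f x - r2 x|)%:E)%E.
Proof.
move=> mf simple1 simple2.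
apply: le_trans (dist_bochner_simple_integral mD muD simple1 simple2) _.
rewrite -ge0_integralD//=; last 2 first.
- by apply/measurable_EFinP; exact: measurable_dist.
- by apply/measurable_EFinP; exact: measurable_dist.
apply: ge0_le_integral => //.
- apply/measurable_EFinP; apply: measurable_dist => // y.
  rewrite (_ : (fun x => _) = (fun x => `|cst y x - r1 x|)).
    by apply: measurable_dist => // z; exact: (measurable_cst `|y - z|).
  by apply/funext => x; rewrite distrC.
- by apply: emeasurable_funD; apply/measurable_EFinP; exact: measurable_dist.
- move=> x _; rewrite -EFinD lee_fin (distrC (f x)) -(subrKA (f x)).
  exact: ler_normD.
Qed.

Variables (f : T -> V) (s : nat -> T -> V).
Hypotheses (mf : forall y, measurable_fun D (fun x => `|f x - y|))
  (simple_s : forall n, bochner_simple mu D (s n))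
  (sf : forall e, 0 < e -> exists N, forall n, (N <= n)%N ->
     forall x, D x -> `|f x - s n x| <= e).

Let integral_dist_small e : 0 < e -> exists N, forall n, (N <= n)%N ->
  (\int[mu]_(x in D) (`|f x - s n x|)%:E <= e%:E)%E.
Proof.
move=> e0; have m0 : 0 <= fine (mu D) by rewrite fine_ge0.
have m1 : 0 < fine (mu D) + 1 by rewrite ltr_wpDl.
have [N sN] := sf (divr_gt0 e0 m1); exists N => n /sN sn.
apply: (@le_trans _ _ ((e / (fine (mu D) + 1))%:E * mu D)%E).
  rewrite -(integral_cst mu mD).
  apply: ge0_le_integral => //.
  by apply/measurable_EFinP; exact: measurable_dist.
have muE : mu D = (fine (mu D))%:E by rewrite fineK// ge0_fin_numE.
rewrite [X in (_ * X)%E]muE -EFinM lee_fin.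
by rewrite mulrAC ler_pdivrMr// ler_wpM2l ?ltW// ltrDl.
Qed.

Lemma is_bochner_uniform_limit (I : V) : is_bochner mu D f I ->
  bochner_simple_integral mu D (s n) @[n --> \oo] --> I.
Proof.
move=> [r [simple_r _ int_r intI]]; apply/cvg_seqP => e e0.
have e3 : 0 < e / 3 by rewrite divr_gt0.
have [N eN] := integral_dist_small e3; exists N => n /eN en.
have /cvg_seqP/(_ _ e3)[N1 IN1] := intI.
have [N2 _ rN2] := int_r _ (@nbhs_open_ereal_lt _ 0 (fun=> e / 3) e3).
have := rN2 (maxn N1 N2) (leq_maxr _ _); have := IN1 _ (leq_maxl N1 N2).
move: (maxn N1 N2) => m mI /= mr.
have := dist_bochner_simple_integral_le mf (simple_s n) (simple_r m).
move=> /le_trans/(_ (leeD en (ltW mr))); rewrite -EFinD lee_fin => nm.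
rewrite -(subrKA (bochner_simple_integral mu D (r m))).
apply: le_trans (ler_normD _ _) _; lra.
Qed.

Lemma is_bochner_exists (VC : seq_complete V) : exists I, is_bochner mu D f I.
Proof.
have [e e0|I sI] := VC (fun n => bochner_simple_integral mu D (s n)).
  have e2 : 0 < e / 2 by rewrite divr_gt0.
  have [N eN] := integral_dist_small e2; exists N => m n /eN em /eN en.
  have := dist_bochner_simple_integral_le mf (simple_s m) (simple_s n).
  move=> /le_trans/(_ (leeD em en)).
  by rewrite -EFinD lee_fin; lra.
exists I, s; split => //.
- apply: aeW => x Dx; apply/cvg_seqP => e e0.
  have [N eN] := sf e0; exists N => n /eN.
  by rewrite distrC; exact.
- apply/fine_cvgP; split.
    have [N eN] := integral_dist_small ltr01; exists N => // n /= /eN en.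
    rewrite ge0_fin_numE ?integral_ge0//.
    by apply: le_lt_trans en _; rewrite ltry.
  apply/(@cvg_seqP _ R^o) => e e0; have [N eN] := integral_dist_small e0.
  exists N => n /eN en /=; rewrite subr0.
  have I0 : (0 <= \int[mu]_(x in D) (`|f x - s n x|)%:E)%E.
    by rewrite integral_ge0.
  rewrite ger0_norm ?fine_ge0// -lee_fin fineK//.
  by rewrite ge0_fin_numE//; apply: le_lt_trans en _; rewrite ltry.
Qed.
End uniform_limit.

Section riemann_sums.
Context (R : realType) (V : normedModType R).
Implicit Types (f : R -> V) (t : R).

Definition unif_cont f := forall e, 0 < e -> exists2 del, 0 < del &
  forall x y, `|x - y| <= del -> `|f x - f y| <= e.

Definition riemann_sum f t n : V :=
  (t / n.+1%:R) *: \sum_(i < n.+1) f (i%:R * (t / n.+1%:R)).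

Lemma lebesgue_measure_segment_lty t :
  (lebesgue_measure `[0%R, t]%classic < +oo)%E.
Proof.
by rewrite lebesgue_measure_itv /=; case: ifP => _; rewrite -?EFinB ltry.
Qed.

Lemma measurable_segment t :
  measurable (`[0, t]%classic : set (measurableTypeR R)).
Proof. exact: measurable_itv. Qed.

Section step.
Context (t : R) (n : nat).
Hypothesis t_ge0 : 0 <= t.
Local Notation h := (t / n.+1%:R).

Let step_index (x : R) : 'I_n.+2 :=
  odflt ord_max [pick i : 'I_n.+2 | i%:R * h <= x < i.+1%:R * h].

Definition step f (x : R) : V := f ((step_index x)%:R * h).

Let h_ge0 : 0 <= h. Proof. by rewrite divr_ge0. Qed.

Let step_index_preimage (i : 'I_n.+2) : i != ord_max ->
  step_index @^-1` [set i] = `[i%:R * h, i.+1%:R * h[%classic.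
Proof.
move=> im; apply/seteqP; split => x /=.
  rewrite /step_index; case: pickP => [j jx /= <-|_ /= iE].
    by rewrite in_itv.
  by rewrite -iE eqxx in im.
rewrite in_itv /= /step_index => /andP[ix xi].
case: pickP => [j /andP[jx xj] /=|/(_ i)]; last by rewrite ix xi.
apply/val_inj => /=.
have h0 : 0 < h.
  rewrite lt_neqAle h_ge0 andbT; apply/eqP => h0.
  by have := le_lt_trans ix xi; rewrite -h0 !mulr0 ltxx.
apply/eqP; rewrite eqn_leq.
have := le_lt_trans jx xi; have := le_lt_trans ix xj.
by rewrite !ltr_pM2r// !ltr_nat !ltnS => -> ->.
Qed.

Let measurable_step_index i :
  measurable (step_index @^-1` [set i] : set (measurableTypeR R)).
Proof.
have mi j : j != ord_max ->
    measurable (step_index @^-1` [set j] : set (measurableTypeR R)).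
  by move=> jm; rewrite step_index_preimage//; exact: measurable_itv.
have [->|/mi//] := eqVneq i ord_max.
rewrite (_ : _ @^-1` _ =
    ~` \bigcup_(j in [set j | j != ord_max]) (step_index @^-1` [set j])).
  apply: measurableC; apply: fin_bigcup_measurable => //.
  exact: finite_finset.
apply/seteqP; split => x /=.
  by move=> xm [j /= + xj]; rewrite -xj xm eqxx.
by move=> nx; apply: contrapT => /eqP xm; apply: nx; exists (step_index x).
Qed.

Let node_last : (@ord_max n.+1)%:R * h = t.
Proof. by rewrite mulrC divfK. Qed.

Let step_indexP x : 0 <= x -> x < t ->
  step_index x != ord_max /\
  (step_index x)%:R * h <= x < (step_index x).+1%:R * h.
Proof.
move=> x0 xt; have h0 : 0 < h by rewrite divr_gt0// (le_lt_trans x0).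
have /andP[] := truncn_itv (divr_ge0 x0 h_ge0).
rewrite ler_pdivlMr// ltr_pdivrMr// => ix xi.
have iN : (Num.truncn (x / h) < n.+2)%N.
  rewrite -(ltr_nat R) -(ltr_pM2r h0); apply: le_lt_trans ix _.
  by apply: (lt_le_trans xt); rewrite -{1}node_last ler_pM2r// ler_nat.
rewrite /step_index; case: pickP => [j /= jx|/(_ (Ordinal iN))]; last first.
  by rewrite /= ix xi.
split=> //; apply/eqP => jm; move: jx => /andP[+ _].
by rewrite jm node_last leNgt xt.
Qed.

Lemma bochner_simple_step f :
  bochner_simple lebesgue_measure `[0, t]%classic (step f).
Proof.
exact: (bochner_simple_index (measurable_segment t)
  (lebesgue_measure_segment_lty t) measurable_step_index
  (fun i : 'I_n.+2 => f (i%:R * h))).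
Qed.

Lemma bochner_simple_integral_step f :
  bochner_simple_integral lebesgue_measure `[0, t]%classic (step f) =
  riemann_sum f t n.
Proof.
have mt := lebesgue_measure_segment_lty t.
have mD := measurable_segment t.
rewrite (bochner_simple_integral_index mD mt measurable_step_index
         (fun i : 'I_n.+2 => f (i%:R * h))).
rewrite big_ord_recr /= [X in _ + X](_ : _ = 0) ?addr0; last first.
  rewrite (_ : fine _ = 0) ?scale0r//.
  apply/eqP; rewrite -(@eqe R) fineK; last first.
    exact: measureI_fin_num.
  rewrite -measure_le0 -(lebesgue_measure_set1 t).
  apply: le_measure; rewrite ?inE//.
    exact: measurableI.
  move=> x /= []; rewrite in_itv /= => /andP[x0 xt] xm.
  apply/eqP; rewrite eq_le xt leNgt; apply/negP => /(step_indexP x0)[].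
  by rewrite xm eqxx.
rewrite /riemann_sum scaler_sumr; apply: eq_bigr => i _; congr (_ *: _).
rewrite step_index_preimage; last by rewrite -val_eqE /= ltn_eqF.
rewrite setIidr => [|x /=].
  rewrite lebesgue_measure_itv /= lte_fin; case: ifPn => [_|].
    by rewrite -EFinB/= -mulrBl -natrB// subSnn mul1r.
  rewrite -leNgt -natr1 mulrDl mul1r gerDl => h_le0.
  by apply/esym/eqP; rewrite eq_le h_le0 h_ge0.
rewrite !in_itv /= => /andP[ix xi]; rewrite (le_trans _ ix) ?mulr_ge0//=.
apply: (le_trans (ltW xi)); rewrite -[leRHS]node_last ler_wpM2r// ler_nat.
exact: ltn_ord.
Qed.

Lemma dist_step f x e : 0 <= x <= t ->
  (forall y, `|x - y| <= h -> `|f x - f y| <= e) -> `|f x - step f x| <= e.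
Proof.
move=> /andP[x0 xt] fe; apply: fe.
move: xt; rewrite le_eqVlt => /predU1P[->|/(step_indexP x0)[_ /andP[ix xi]]].
  rewrite /step_index; case: pickP => [j /= /andP[jt tj]|_ /=].
    rewrite ger0_norm ?subr_ge0// lerBlDl ltW//.
    by move: tj; rewrite -natr1 mulrDl mul1r.
  by rewrite node_last subrr normr0.
rewrite ger0_norm ?subr_ge0// lerBlDl ltW//.
by move: xi; rewrite -natr1 mulrDl mul1r.
Qed.

End step.

Section continuous.
Context (t : R) (f : R -> V).
Hypotheses (t_ge0 : 0 <= t) (uf : unif_cont f).

Let mD := measurable_segment t.

Let mf y : measurable_fun `[0, t]%classic (fun x => `|f x - y|).
Proof.
apply: measurable_funTS; apply: continuous_measurable_fun => x.
apply/cvgrPdist_le => e e0; have [del del0 fd] := uf e0.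
exists del => //= z /ltW xz; apply: le_trans (ler_dist_dist _ _) _.
by rewrite opprB addrA subrK; exact: fd.
Qed.

Let step_unif e : 0 < e -> exists N, forall n, (N <= n)%N ->
  forall x, `[0, t]%classic x -> `|f x - step t n f x| <= e.
Proof.
move=> e0; have [del del0 fd] := uf e0.
have [N tN] : exists N : nat, t / del <= N%:R.
  exists (Num.truncn (t / del)).+1; apply/ltW.
  by have /andP[] := truncn_itv (divr_ge0 t_ge0 (ltW del0)).
exists N => n Nn x /=; rewrite in_itv /= => xt.
apply: (dist_step t_ge0 xt) => y xy; apply: fd; apply: le_trans xy _.
rewrite ler_pdivrMr// mulrC -ler_pdivrMr//.
by apply: le_trans tN _; rewrite ler_nat (leq_trans Nn).
Qed.

Lemma is_bochner_riemann (I : V) :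
  is_bochner lebesgue_measure `[0, t]%classic f I ->
  riemann_sum f t n @[n --> \oo] --> I.
Proof.
move=> fI; rewrite (_ : riemann_sum f t = fun n =>
  bochner_simple_integral lebesgue_measure `[0, t]%classic (step t n f)).
  apply: (is_bochner_uniform_limit mD
    (lebesgue_measure_segment_lty t) mf) => //.
  by move=> n; exact: bochner_simple_step.
by apply/funext => n; rewrite bochner_simple_integral_step.
Qed.

Lemma is_bochner_unif_cont (VC : seq_complete V) :
  exists I, is_bochner lebesgue_measure `[0, t]%classic f I.
Proof.
apply: (is_bochner_exists mD (lebesgue_measure_segment_lty t) mf _
  step_unif VC).
by move=> n; exact: bochner_simple_step.
Qed.

End continuous.
End riemann_sums.

(** * Fourier series *)

Section complex_numbers.
Context (R : realType).
Implicit Types (x y : R) (z w : Rcomplex R).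

Lemma norm_mulC z w : `|z * w : Rcomplex R| = `|z| * `|w|.
Proof. exact: Normc.normcM. Qed.

Lemma norm_cis x : `|cis x| = 1.
Proof. by rewrite /Num.norm /= cos2Dsin2 sqrtr1. Qed.

Lemma Rcomplex_norm_conj z : `|conjc z : Rcomplex R| = `|z|.
Proof. by case: z => a b; rewrite /Num.norm /= sqrrN. Qed.

Lemma cisD x y : cis (x + y) = cis x * cis y.
Proof.
rewrite /cis cosD sinD; congr Complex.
by rewrite addrC (mulrC (cos x)).
Qed.

Lemma cis0 : cis 0 = 1 :> Rcomplex R.
Proof. by rewrite /cis cos0 sin0. Qed.

Lemma conj_cis x : conjc (cis x) = cis (- x) :> Rcomplex R.
Proof. by rewrite /cis /= cosN sinN. Qed.

Lemma conjcM z w : conjc (z * w) = conjc z * conjc w.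
Proof. exact: rmorphM. Qed.

Lemma cisX x n : cis x ^+ n = cis (n%:R * x).
Proof.
elim: n => [|n IH]; first by rewrite mul0r cis0.
by rewrite exprS IH -cisD -nat1r mulrDl mul1r.
Qed.

Lemma cis_nat_period n : cis (n%:R * (2 * pi)) = 1 :> Rcomplex R.
Proof.
rewrite -cisX (_ : cis _ = 1) ?expr1n//.
by rewrite /cis mulr_natl cos2pi sin2pi.
Qed.

Lemma cis_int_period (K : int) : cis (K%:~R * (2 * pi)) = 1 :> Rcomplex R.
Proof.
case: K => n; first exact: cis_nat_period.
by rewrite NegzE mulrNz mulNr -conj_cis cis_nat_period /= oppr0.
Qed.

Lemma ge_Re z : `|complex.Re z| <= `|z|.
Proof.
case: z => a b /=; rewrite -sqrtr_sqr ler_wsqrtr// lerDl sqr_ge0//.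
Qed.

Lemma ge_Im z : `|complex.Im z| <= `|z|.
Proof.
case: z => a b /=; rewrite -sqrtr_sqr ler_wsqrtr// lerDr sqr_ge0//.
Qed.

Lemma norm_real x : `|Complex x 0 : Rcomplex R| = `|x|.
Proof. by rewrite {1}/Num.norm /= expr0n addr0 sqrtr_sqr. Qed.

Lemma norm_imag x : `|Complex 0 x : Rcomplex R| = `|x|.
Proof. by rewrite {1}/Num.norm /= expr0n add0r sqrtr_sqr. Qed.

Lemma norm_le_ReIm z : `|z| <= `|complex.Re z| + `|complex.Im z|.
Proof.
case: z => a b; rewrite -norm_real -norm_imag.
by apply: le_trans (ler_normD _ _); rewrite -[_ + _]/(Complex _ _) addr0 add0r.
Qed.

Lemma mulC_conj z : z * conjc z = Complex (`|z| ^+ 2) 0.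
Proof.
case: z => a b; rewrite /Num.norm /= sqr_sqrtr ?addr_ge0 ?sqr_ge0//.
by congr Complex; rewrite /= ?mulrN ?opprK -?expr2 // mulrC addNr.
Qed.

Lemma scaleC_mul x z : x *: z = Complex x 0 * z.
Proof. by case: z => a b; congr Complex; rewrite !mul0r ?subr0 ?addr0. Qed.

Lemma cis_continuous0 e : 0 < e ->
  exists2 del, 0 < del &
    forall x, `|x| <= del -> `|cis x - 1 : Rcomplex R| <= e.
Proof.
move=> e0; have e2 : 0 < e / 2 by rewrite divr_gt0.
have /cvgrPdist_le/(_ _ e2)[d1 /= d10 c1] := @continuous_cos R 0.
have /cvgrPdist_le/(_ _ e2)[d2 /= d20 c2] := @continuous_sin R 0.
have d0 : 0 < Num.min d1 d2 by rewrite lt_min d10.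
exists (Num.min d1 d2 / 2) => [|x xd]; first by rewrite divr_gt0.
have : `|0 - x| < Num.min d1 d2.
  by rewrite sub0r normrN; apply: le_lt_trans xd _; lra.
rewrite lt_min => /andP[/c1 + /c2]; rewrite cos0 sin0.
rewrite distrC sub0r normrN => cx sx.
apply: le_trans (norm_le_ReIm _) _; rewrite /= subr0; lra.
Qed.

End complex_numbers.

Lemma completeNormed_seq_complete (R : realType) (V : completeNormedModType R) :
  seq_complete V.
Proof.
move=> u uC; suff /cauchy_cvg uV : cauchy (u n @[n --> \oo]).
  by exists (lim (u n @[n --> \oo])).
apply: cauchy_exP => e e0; have e2 : 0 < e / 2 by rewrite divr_gt0.
have [N uN] := uC _ e2; exists (u N); exists N => // n /= Nn.
rewrite -ball_normE /ball_ /=; apply: le_lt_trans (uN _ _ (leqnn N) Nn) _.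
by rewrite ltr_pdivrMr// ltr_pMr// ltr1n.
Qed.

Section Hper_norm.
Context (R : realType) (L l : R) (C : {posnum R}).
Local Notation H := (Hper L l C).
Implicit Types (u v w : H) (c : int -> Rcomplex R).

Definition weight (K : int) : R := (1 + K%:~R ^+ 2) `^ l.

Lemma weight_gt0 K : 0 < weight K.
Proof. by rewrite powR_gt0// ltr_pwDl ?sqr_ge0. Qed.

Lemma normHE u : `|u| = C%:num * Num.sqrt (fine (energy l (coef u))).
Proof. by []. Qed.

Lemma energy_ge_sum c (s : seq int) : uniq s ->
  ((\sum_(K <- s) weight K * `|c K| ^+ 2)%:E <= energy l c)%E.
Proof.
move=> us; apply: esum_ge; exists [set` s].
  by split => //; exact: finite_seq.
by rewrite -fsbig_seq// sumEFin.
Qed.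

Lemma energy_le c (M : R) :
  (forall s, uniq s -> \sum_(K <- s) weight K * `|c K| ^+ 2 <= M) ->
  (energy l c <= M%:E)%E.
Proof.
move=> cM; apply: ge_ereal_sup => _ /= [A [finA _] <-].
by rewrite fsbig_finite// sumEFin lee_fin cM// finmap.fset_uniq.
Qed.

Lemma finite_energy_le c (M : R) :
  (forall s, uniq s -> \sum_(K <- s) weight K * `|c K| ^+ 2 <= M) ->
  c \in finite_energy l.
Proof.
by move=> /energy_le cM; rewrite unfold_in; apply: le_lt_trans cM (ltry _).
Qed.

Lemma sum_le_norm u (s : seq int) : uniq s ->
  \sum_(K <- s) weight K * `|coef u K| ^+ 2 <= (`|u| / C%:num) ^+ 2.
Proof.
move=> us; rewrite normHE mulrAC mulfV// mul1r sqr_sqrtr; last first.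
  by rewrite fine_ge0// energy_ge0.
by rewrite -lee_fin fineK ?coef_fin_num// energy_ge_sum.
Qed.

Lemma norm_le_sum u e : 0 <= e ->
  (forall s, uniq s ->
    \sum_(K <- s) weight K * `|coef u K| ^+ 2 <= (e / C%:num) ^+ 2) ->
  `|u| <= e.
Proof.
move=> e0 /energy_le; rewrite -(fineK (coef_fin_num u)) lee_fin => ue.
have eC : 0 <= e / C%:num by rewrite divr_ge0.
rewrite normHE mulrC -ler_pdivlMr// -(ger0_norm eC) -sqrtr_sqr.
exact: ler_wsqrtr.
Qed.

Lemma finite_energy_coef c u :
  (forall K, `|c K| <= `|coef u K|) -> c \in finite_energy l.
Proof.
move=> cu; apply: (@finite_energy_le _ ((`|u| / C%:num) ^+ 2)) => s us.
apply: le_trans (sum_le_norm u us); apply: ler_sum => K _.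
by rewrite ler_pM2l ?weight_gt0// lerXn2r ?nnegrE.
Qed.

Lemma norm_le_coef u v :
  (forall K, `|coef u K| <= `|coef v K|) -> `|u| <= `|v|.
Proof.
move=> uv; apply: norm_le_sum => // s us.
apply: le_trans (sum_le_norm v us); apply: ler_sum => K _.
by rewrite ler_pM2l ?weight_gt0// lerXn2r ?nnegrE.
Qed.

Lemma coef_Finv c : c \in finite_energy l -> coef (Finv c : H) = c.
Proof. by move=> cl; rewrite /Finv -[coef _]/(\val _) insubdK. Qed.

Lemma coef_inj u v : (forall K, coef u K = coef v K) -> u = v.
Proof. by move=> uv; apply: val_inj; apply/funext. Qed.

Lemma Hper_coefD u v K : coef (u + v) K = coef u K + coef v K.
Proof. by []. Qed.

Lemma Hper_coefN u K : coef (- u) K = - coef u K.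
Proof. by []. Qed.

Lemma Hper_coefZ (x : R) u K : coef (x *: u) K = x *: coef u K.
Proof. by []. Qed.

Lemma Hper_coef_sum (I : Type) (s : seq I) (F : I -> H) K :
  coef (\sum_(i <- s) F i) K = \sum_(i <- s) coef (F i) K.
Proof. by elim/big_rec2: _ => // i y1 y2 _ <-. Qed.

Lemma norm_coef_le K : exists2 M, 0 < M & forall u, `|coef u K| <= M * `|u|.
Proof.
have w0 : 0 < Num.sqrt (weight K) by rewrite sqrtr_gt0 weight_gt0.
exists (C%:num * Num.sqrt (weight K))^-1; first by rewrite invr_gt0 mulr_gt0.
move=> u; have := sum_le_norm u (isT : uniq [:: K]).
rewrite big_seq1 -{1}(sqr_sqrtr (ltW (weight_gt0 K))) -exprMn.
rewrite ler_pXn2r ?nnegrE ?mulr_ge0 ?divr_ge0 ?sqrtr_ge0// ler_pdivlMr// => uK.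
by rewrite mulrC ler_pdivlMr ?mulr_gt0// mulrCA mulrC (mulrC `|_|).
Qed.

Lemma normC_sqr (z : Rcomplex R) :
  `|z| ^+ 2 = complex.Re z ^+ 2 + complex.Im z ^+ 2.
Proof. by case: z => a b; rewrite sqr_sqrtr// addr_ge0 ?sqr_ge0. Qed.

Lemma Hper_seq_complete : seq_complete H.
Proof.
move=> u uC.
have coefC K e : 0 < e -> exists N, forall m n, (N <= m)%N -> (N <= n)%N ->
    `|coef (u m) K - coef (u n) K| <= e.
  move=> e0; have [M M0 uM] := norm_coef_le K.
  have [N uN] := uC _ (divr_gt0 e0 M0); exists N => m n Nm Nn.
  rewrite -Hper_coefN -Hper_coefD; apply: le_trans (uM _) _.
  by rewrite mulrC -ler_pdivlMr// uN.
have ReC K : exists x : R, (complex.Re (coef (u n) K)) @[n --> \oo] --> x.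
  apply: (@completeNormed_seq_complete R R^o) => e /(coefC K)[N uN].
  exists N => m n Nm Nn; rewrite -raddfB; apply: le_trans (uN m n Nm Nn).
  exact: ge_Re.
have ImC K : exists x : R, (complex.Im (coef (u n) K)) @[n --> \oo] --> x.
  apply: (@completeNormed_seq_complete R R^o) => e /(coefC K)[N uN].
  exists N => m n Nm Nn; rewrite -raddfB; apply: le_trans (uN m n Nm Nn).
  exact: ge_Im.
have [a aE] := choice ReC; have [b bE] := choice ImC.
pose c K : Rcomplex R := Complex (a K) (b K).
have cu e : 0 < e -> exists N, forall n, (N <= n)%N -> forall s, uniq s ->
    \sum_(K <- s) weight K * `|c K - coef (u n) K| ^+ 2 <= (e / C%:num) ^+ 2.
  move=> e0; have [N uN] := uC e e0; exists N => n Nn s us.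
  have lim_sum : (\sum_(K <- s) weight K *
      `|coef (u m) K - coef (u n) K| ^+ 2) @[m --> \oo] -->
      \sum_(K <- s) weight K * `|c K - coef (u n) K| ^+ 2.
    apply: cvg_big => [|K _]; first exact: add_continuous.
    apply: cvgM; first exact: cvg_cst.
    rewrite normC_sqr !raddfB.
    under eq_fun do rewrite normC_sqr !raddfB.
    have cvg_sqrB (g : nat -> R) (y z : R) : g m @[m --> \oo] --> y ->
        (g m - z) ^+ 2 @[m --> \oo] --> (y - z) ^+ 2.
      move=> gy; have gyz : (g m - z) @[m --> \oo] --> y - z.
        by apply: cvgB => //; exact: cvg_cst.
      exact: (cvgM gyz gyz).
    apply: cvgD; [exact: (cvg_sqrB _ _ _ (aE K))|].
    exact: (cvg_sqrB _ _ _ (bE K)).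
  rewrite -(cvg_lim _ lim_sum)//; apply: limr_le.
    by apply/cvg_ex; eexists; exact: lim_sum.
  exists N => // m /= Nm.
  apply: (le_trans (sum_le_norm (u m - u n) us)).
  by rewrite lerXn2r ?nnegrE ?divr_ge0 ?(ltW e0)// ler_pM2r// uN.
have [N0 cu0] := cu 1 ltr01.
have dP : (fun K => c K - coef (u N0) K : Rcomplex R) \in finite_energy l.
  by apply: finite_energy_le (cu0 _ (leqnn _)).
pose x : H := MkHper L C dP + u N0.
have xE K : coef x K = c K by rewrite Hper_coefD /= subrK.
exists x; apply/cvg_seqP => e e0; have [N cuN] := cu e e0.
exists N => n Nn; rewrite distrC; apply: norm_le_sum; first exact: ltW.
move=> s us; under eq_bigr do rewrite Hper_coefD Hper_coefN xE.
exact: cuN.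
Qed.

End Hper_norm.

Definition zr (n : nat) : seq int := [seq k%:Z - n%:Z | k <- iota 0 n.*2.+1].

Lemma mem_zr n (K : int) : (K \in zr n) = (absz K <= n)%N.
Proof.
apply/mapP/idP => [[k]|Kn]; first by rewrite mem_iota => kn ->; lia.
by exists (absz (K + n%:Z)); [rewrite mem_iota; lia|lia].
Qed.

Lemma zr_uniq n : uniq (zr n).
Proof.
rewrite map_inj_uniq ?iota_uniq// => j k /eqP.
by rewrite (inj_eq (addIr _)) => /eqP[].
Qed.

Lemma perm_zr_filter n m : (n <= m)%N ->
  perm_eq [seq K <- zr m | K \in zr n] (zr n).
Proof.
move=> nm; apply: uniq_perm; rewrite ?filter_uniq ?zr_uniq// => K.
by rewrite mem_filter !mem_zr; lia.
Qed.

Lemma perm_zr_opp n : perm_eq [seq - K | K <- zr n] (zr n).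
Proof.
apply: uniq_perm; rewrite ?(map_inj_uniq (@oppr_inj _)) ?zr_uniq// => K.
rewrite -[X in X \in map _ _]opprK mem_map; last exact: oppr_inj.
by rewrite !mem_zr abszN.
Qed.

Lemma seq_sub_zr (s : seq int) :
  exists N, forall n, (N <= n)%N -> {subset s <= zr n}.
Proof.
exists (\max_(K <- s) absz K)%N => n sn K Ks; rewrite mem_zr.
by apply: leq_trans sn; rewrite (big_rem K)//= leq_maxl.
Qed.

Section zseries.
Context (R : realType).
Implicit Types (f g : int -> Rcomplex R) (z w : Rcomplex R).

Definition zconv f z :=
  (complex.Re (\sum_(K <- zr n) f K) @[n --> \oo] --> complex.Re z) /\
  (complex.Im (\sum_(K <- zr n) f K) @[n --> \oo] --> complex.Im z).

Lemma zconv_zseries f z : zconv f z -> zseries f = z.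
Proof.
have S N : \sum_(0 <= k < N.*2.+1) f (k%:Z - N%:Z) = \sum_(K <- zr N) f K.
  by rewrite big_map /index_iota subn0.
move=> [fRe fIm]; rewrite /zseries.
under eq_fun do rewrite S; under [X in Complex _ (limn X)]eq_fun do rewrite S.
by rewrite (cvg_lim _ fRe)// (cvg_lim _ fIm)//; case: (z).
Qed.

Lemma eq_zconv f g z : f =1 g -> zconv f z -> zconv g z.
Proof. by move=> /funext ->. Qed.

Lemma zconvD f g z w : zconv f z -> zconv g w ->
  zconv (fun K => f K + g K) (z + w).
Proof.
move=> [fRe fIm] [gRe gIm]; split; under eq_fun do rewrite big_split raddfD;
  rewrite raddfD; exact: cvgD.
Qed.

Lemma zconvZ (x : R) f z : zconv f z -> zconv (fun K => x *: f K) (x *: z).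
Proof.
move=> [fRe fIm]; split; under eq_fun do rewrite -scaler_sumr linearZ;
  rewrite linearZ; exact: cvgZl_tmp.
Qed.

Lemma zconv0 : zconv (fun=> 0) 0.
Proof. by split; under eq_fun do rewrite big1//; exact: cvg_cst. Qed.

Lemma zconv_sum (I : Type) (s : seq I) (f : I -> int -> Rcomplex R)
    (z : I -> Rcomplex R) :
  (forall i, zconv (f i) (z i)) ->
  zconv (fun K => \sum_(i <- s) f i K) (\sum_(i <- s) z i).
Proof.
move=> fz; elim: s => [|i s IH].
  by under eq_fun do rewrite big_nil; rewrite big_nil; exact: zconv0.
by under eq_fun do rewrite big_cons; rewrite big_cons; exact: zconvD.
Qed.

Lemma zconv_mono (J : int) z : zconv (fun K => if K == J then z else 0) z.
Proof.
have S n : (absz J <= n)%N -> \sum_(K <- zr n) (if K == J then z else 0) = z.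
  move=> Jn; rewrite (bigD1_seq J) ?mem_zr ?zr_uniq//= eqxx big1 ?addr0//.
  by move=> K /negbTE ->.
by split; apply: cvg_near_cst; exists (absz J) => // n /= Jn; rewrite S.
Qed.

Lemma zconv_conj f z : zconv f z -> zconv (fun K => conjc (f (- K))) (conjc z).
Proof.
have S n : \sum_(K <- zr n) conjc (f (- K)) = conjc (\sum_(K <- zr n) f K).
  rewrite raddf_sum -(big_map (fun K => - K) xpredT (fun K => conjc (f K))).
  exact: perm_big (perm_zr_opp n).
have ReC (w : Rcomplex R) : complex.Re (conjc w) = complex.Re w by case: w.
have ImC (w : Rcomplex R) : complex.Im (conjc w) = - complex.Im w by case: w.
move=> [fRe fIm]; split; under eq_fun do rewrite S ?ReC ?ImC.
  by rewrite ReC.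
by rewrite ImC; exact: cvgN.
Qed.

Lemma sum_zr_le (h : int -> R) n m : (forall K, 0 <= h K) -> (n <= m)%N ->
  \sum_(K <- zr n) h K <= \sum_(K <- zr m) h K.
Proof.
move=> h0 nm; rewrite -[leLHS](perm_big _ (perm_zr_filter nm)) big_filter.
rewrite [leRHS](bigID (fun K => K \in zr n))/= lerDl.
by apply: sumr_ge0 => K _.
Qed.

Lemma sum_zr_cvg (h : int -> R) (M : R) :
  (forall n, \sum_(K <- zr n) `|h K| <= M) ->
  cvgn (fun n => \sum_(K <- zr n) h K).
Proof.
move=> hM.
have cvg1 : cvgn (fun n => \sum_(K <- zr n) `|h K|).
  apply: nondecreasing_is_cvgn; first by move=> n m nm; exact: sum_zr_le.
  by exists M => _ [n _ <-].
have cvg2 : cvgn (fun n => \sum_(K <- zr n) (h K + `|h K|)).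
  apply: nondecreasing_is_cvgn => [n m nm|].
    by apply: sum_zr_le => // K; rewrite -lerBlDr sub0r lerNl -normrN ler_norm.
  exists (M + M) => _ [n _ <-]; apply: le_trans (lerD (hM n) (hM n)).
  by rewrite -big_split; apply: ler_sum => K _; rewrite lerD2r ler_norm.
rewrite (_ : (fun _ => _) = (fun n => \sum_(K <- zr n) (h K + `|h K|)
                                      - \sum_(K <- zr n) `|h K|)).
  exact: is_cvgB.
by apply/funext => n; rewrite big_split /= addrK.
Qed.

Lemma zconv_abs f (M : R) : (forall n, \sum_(K <- zr n) `|f K| <= M) ->
  zconv f (zseries f).
Proof.
move=> fM.
have /cvg_ex[a fa] : cvgn (fun n => \sum_(K <- zr n) complex.Re (f K)).
  apply: (@sum_zr_cvg _ M) => n; apply: le_trans (fM n).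
  by apply: ler_sum => K _; exact: ge_Re.
have /cvg_ex[b fb] : cvgn (fun n => \sum_(K <- zr n) complex.Im (f K)).
  apply: (@sum_zr_cvg _ M) => n; apply: le_trans (fM n).
  by apply: ler_sum => K _; exact: ge_Im.
have fab : zconv f (Complex a b).
  by split; under eq_fun do rewrite raddf_sum.
by rewrite (zconv_zseries fab).
Qed.

End zseries.

Section esum_int.
Context (R : realType) (g : int -> R).
Hypotheses (g0 : forall K, 0 <= g K)
  (gfin : (\esum_(K in [set: int]) (g K)%:E < +oo)%E).
Local Notation G := (\esum_(K in [set: int]) (g K)%:E)%E.

Let Gfin : G \is a fin_num.
Proof. by rewrite ge0_fin_numE// esum_ge0// => K _; rewrite lee_fin. Qed.

Lemma sum_le_esum (s : seq int) : uniq s -> \sum_(K <- s) g K <= fine G.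
Proof.
move=> us; rewrite -lee_fin fineK//; apply: esum_ge; exists [set` s].
  by split => //; exact: finite_seq.
by rewrite -fsbig_seq// sumEFin.
Qed.

Lemma esum_zr_le (e : R) : 0 < e -> exists N, forall n, (N <= n)%N ->
  fine G - e <= \sum_(K <- zr n) g K.
Proof.
move=> e0; have [_ [A [finA _] <-] GA] := ub_ereal_sup_adherent e0 Gfin.
have [N sN] := seq_sub_zr (finmap.enum_fset (fset_set A)).
exists N => n /sN sn; rewrite -lee_fin EFinB fineK//.
apply: le_trans (ltW GA) _; rewrite fsbig_finite// sumEFin lee_fin.
have us := finmap.fset_uniq (fset_set A).
have pe : perm_eq [seq K <- zr n | K \in finmap.enum_fset (fset_set A)]
    (finmap.enum_fset (fset_set A)).
  apply: uniq_perm; rewrite ?filter_uniq ?zr_uniq// => K.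
  by rewrite mem_filter; case: (boolP (K \in _)) => //= /sn.
rewrite [leRHS](bigID (fun K => K \in finmap.enum_fset (fset_set A)))/=.
rewrite -[X in _ <= X + _]big_filter (perm_big _ pe).
by rewrite lerDl sumr_ge0.
Qed.

Lemma esum_zr_tail (e : R) : 0 < e -> exists N, forall n, (N <= n)%N ->
  forall s, uniq s -> \sum_(K <- s | K \notin zr n) g K <= e.
Proof.
move=> /esum_zr_le[N gN]; exists N => n /gN gn s us.
have : uniq (zr n ++ [seq K <- s | K \notin zr n]).
  rewrite cat_uniq zr_uniq filter_uniq// andbT /=.
  by apply/hasPn => K; rewrite mem_filter => /andP[].
by move=> /sum_le_esum; rewrite big_cat/= big_filter; lra.
Qed.

End esum_int.

Section trigonometric_polynomials.
Context (R : realType) (L l : R) (C : {posnum R}).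
Local Notation H := (Hper L l C).
Implicit Types (u v w : H) (y z : Rcomplex R).

Definition mono (K : int) z : H := Finv (fun J => if J == K then z else 0).

Lemma coef_mono K z J : coef (mono K z) J = if J == K then z else 0.
Proof.
rewrite coef_Finv//; apply: (@finite_energy_le _ _ _ (weight l K * `|z| ^+ 2)).
move=> s us; have [Ks|Ks] := boolP (K \in s).
  rewrite (bigD1_seq K)//= eqxx big1 ?addr0// => i /negbTE ->.
  by rewrite normr0 expr0n mulr0.
rewrite big1_seq => [|i /= is_].
  by rewrite mulr_ge0 ?sqr_ge0// ltW// weight_gt0.
case: eqP => [iK|_]; last by rewrite normr0 expr0n mulr0.
by rewrite -iK is_ in Ks.
Qed.

Lemma monoB K z y : mono K (z - y) = mono K z - mono K y.
Proof.
apply: coef_inj => J; rewrite Hper_coefD Hper_coefN !coef_mono.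
by case: eqP; rewrite ?subr0.
Qed.

Lemma monoZ K (x : R) z : mono K (x *: z) = x *: mono K z.
Proof.
apply: coef_inj => J; rewrite Hper_coefZ !coef_mono.
by case: eqP; rewrite ?scaler0.
Qed.

Lemma mono_sum K (I : Type) (s : seq I) (f : I -> Rcomplex R) :
  mono K (\sum_(i <- s) f i) = \sum_(i <- s) mono K (f i).
Proof.
apply: coef_inj => J; rewrite Hper_coef_sum coef_mono.
case: eqP => JK; first by apply: eq_bigr => i _; rewrite coef_mono JK eqxx.
by rewrite big1// => i _; rewrite coef_mono; case: eqP.
Qed.

Lemma norm_mono_mul K z y : `|mono K (z * y)| = `|z| * `|mono K y|.
Proof.
have [->|z0] := eqVneq z 0.
  rewrite mul0r normr0 mul0r (_ : mono K 0 = 0) ?normr0//.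
  by apply: coef_inj => J; rewrite coef_mono; case: eqP.
have le u v (x : R) : 0 <= x -> (forall J, `|coef u J| <= x * `|coef v J|) ->
    `|u| <= x * `|v|.
  move=> x0 uv; rewrite -(ger0_norm x0) -normrZ; apply: norm_le_coef => J.
  by rewrite Hper_coefZ RcomplexZ_norm ger0_norm.
apply/eqP; rewrite eq_le le => [|//|J]; last first.
  by rewrite !coef_mono; case: eqP; rewrite ?norm_mulC ?normr0 ?mulr0.
have nz0 : 0 < `|z| by rewrite normr_gt0.
rewrite /= -ler_pdivlMl// le ?invr_ge0// => J.
rewrite !coef_mono; case: eqP; rewrite ?normr0 ?mulr0// norm_mulC.
by rewrite mulKf ?gt_eqF.
Qed.

Definition trunc (s : seq int) u : H := \sum_(K <- s) mono K (coef u K).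

Lemma coef_trunc s u J : uniq s ->
  coef (trunc s u) J = if J \in s then coef u J else 0.
Proof.
move=> us; rewrite /trunc Hper_coef_sum; case: ifPn => Js.
  rewrite (bigD1_seq J)//= coef_mono eqxx big1 ?addr0// => K KJ.
  by rewrite coef_mono eq_sym (negbTE KJ).
rewrite big1_seq// => K /= Ks; rewrite coef_mono; case: eqP => // JK.
by rewrite JK Ks in Js.
Qed.

Lemma norm_trunc_le s u : uniq s -> `|trunc s u| <= `|u|.
Proof.
move=> us; apply: norm_le_coef => K; rewrite coef_trunc//.
by case: ifP; rewrite ?normr0.
Qed.

Lemma trunc_cvg u : trunc (zr n) u @[n --> \oo] --> u.
Proof.
apply/cvg_seqP => e e0.
have d0 : 0 < (e / C%:num) ^+ 2 by rewrite exprn_gt0// divr_gt0.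
have g0 K : 0 <= weight l K * `|coef u K| ^+ 2.
  by rewrite mulr_ge0 ?sqr_ge0// ltW// weight_gt0.
have := coefP u; rewrite unfold_in => /(esum_zr_tail g0)/(_ _ d0)[N uN].
exists N => n /uN un; apply: norm_le_sum; first exact: ltW.
move=> s us; apply: le_trans (un s us).
rewrite [leRHS]big_mkcond; apply: ler_sum => K _.
rewrite Hper_coefD Hper_coefN coef_trunc ?zr_uniq//; case: ifP => _ /=.
  by rewrite subrr normr0 expr0n mulr0.
by rewrite sub0r normrN.
Qed.
End trigonometric_polynomials.
Arguments mono {R L l C}.

Section evaluation.
Context (R : realType) (L l : R) (C : {posnum R}).
Hypotheses (L_gt0 : 0 < L) (C_large : admissible_norm L l C).
Local Notation H := (Hper L l C).
Implicit Types (u v w : H) (y z : Rcomplex R).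

Lemma Heval_sum_mono (I : Type) (s : seq I) (F : I -> int)
    (g : I -> Rcomplex R) (x : R) :
  (\sum_(i <- s) (mono (F i) (g i) : H)) x =
  \sum_(i <- s) g i * cis (2 * pi * (F i)%:~R * x / L).
Proof.
apply/zconv_zseries/eq_zconv; last first.
  apply: zconv_sum => i.
  exact: zconv_mono (F i) (g i * cis (2 * pi * (F i)%:~R * x / L)).
move=> K /=; rewrite Hper_coef_sum mulr_suml; apply: eq_bigr => i _.
by rewrite coef_mono; case: eqP => [->//|_]; rewrite mul0r.
Qed.

Lemma Heval_mono K z (x : R) :
  (mono K z : H) x = z * cis (2 * pi * K%:~R * x / L).
Proof.
have := Heval_sum_mono [:: K] id (fun=> z) x.
by rewrite !big_seq1.
Qed.

Definition translate (t : R) u : H :=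
  Finv (fun K => coef u K * cis (2 * pi * K%:~R * t / L)).

Lemma coef_translate t u K :
  coef (translate t u) K = coef u K * cis (2 * pi * K%:~R * t / L).
Proof.
rewrite coef_Finv//; apply: (@finite_energy_coef _ L _ C _ u) => J.
by rewrite norm_mulC norm_cis mulr1.
Qed.

Lemma Heval_translate t u (x : R) : translate t u x = u (x + t).
Proof.
rewrite /Heval; congr zseries; apply/funext => K.
rewrite coef_translate -mulrA -cisD; congr (_ * cis _).
by rewrite -mulrDl -mulrDr addrC.
Qed.

(* [admissible_norm] bounds [u] only inside (0, L); every other point is a
   translate of [L / 2]. *)
Lemma Heval_norm_le u (x : R) : `|u x| <= `|u|.
Proof.
have [_ /(_ (translate (x - L / 2) u) (L / 2))] := C_large.
rewrite Heval_translate addrC subrK => uL; apply: (le_trans (uL _)).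
  by rewrite divr_gt0//= gtr_pMr// invf_lt1// ltr1n.
by apply: norm_le_coef => K; rewrite coef_translate norm_mulC norm_cis mulr1.
Qed.

(* Apply the sup bound at 0 to the trigonometric polynomial with coefficients
   [`|coef u K|]. *)
Lemma sum_norm_coef_le u (s : seq int) : uniq s ->
  \sum_(K <- s) `|coef u K| <= `|u|.
Proof.
move=> us; pose p : H := \sum_(K <- s) mono K (Complex `|coef u K| 0).
apply: (@le_trans _ _ `|p|).
  apply: le_trans (Heval_norm_le p 0); rewrite Heval_sum_mono.
  apply: le_trans (ge_Re _); rewrite raddf_sum; apply: le_trans (ler_norm _).
  apply: ler_sum => K _.
  by rewrite mulr0 mul0r cis0 mulr1.
apply: norm_le_coef => K.
rewrite Hper_coef_sum; case: (boolP (K \in s)) => Ks; last first.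
  rewrite big1_seq ?normr0// => J /= Js; rewrite coef_mono; case: eqP => // JK.
  by rewrite JK Js in Ks.
rewrite (bigD1_seq K)//= coef_mono eqxx big1 ?addr0 => [|J JK].
  by rewrite norm_real normr_id.
by rewrite coef_mono eq_sym (negbTE JK).
Qed.

Lemma norm_coef_le_norm u K : `|coef u K| <= `|u|.
Proof.
by have := sum_norm_coef_le u (isT : uniq [:: K]); rewrite big_seq1.
Qed.

Lemma zconv_Heval u (x : R) :
  zconv (fun K => coef u K * cis (2 * pi * K%:~R * x / L)) (u x).
Proof.
apply: (@zconv_abs _ _ `|u|) => n.
apply: le_trans (sum_norm_coef_le u (zr_uniq n)); apply: ler_sum => K _.
by rewrite norm_mulC norm_cis mulr1.
Qed.

Lemma HevalD u v (x : R) : (u + v) x = u x + v x.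
Proof.
apply: zconv_zseries.
apply: eq_zconv (zconvD (zconv_Heval u x) (zconv_Heval v x)) => K.
by rewrite -mulrDl.
Qed.

Lemma HevalZ (r : R) u (x : R) : (r *: u) x = r *: u x.
Proof.
apply: zconv_zseries; apply: eq_zconv (zconvZ r (zconv_Heval u x)) => K.
by rewrite Hper_coefZ !scaleC_mul mulrA.
Qed.

Lemma HevalN u (x : R) : (- u) x = - u x.
Proof. by rewrite -scaleN1r HevalZ scaleN1r. Qed.

Lemma Heval0 (x : R) : (0 : H) x = 0.
Proof.
by apply: zconv_zseries; apply: eq_zconv (@zconv0 R) => K; rewrite mul0r.
Qed.

(* If [u] vanishes pointwise, then [u] is the pointwise product of [0] by [0],
   so that submultiplicativity gives [`|u| <= 0]. *)
Lemma Heval_inj u v : (forall x, u x = v x) -> u = v.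
Proof.
move=> uv; apply/eqP; rewrite -subr_eq0 -normr_le0.
have [/(_ 0 0 (u - v)) + _] := C_large; rewrite normr0 mul0r; apply=> x.
by rewrite HevalD HevalN uv subrr Heval0 mul0r.
Qed.

Definition conjH u : H := Finv (fun K => conjc (coef u (- K))).

Lemma coef_conjH u K : coef (conjH u) K = conjc (coef u (- K)).
Proof.
rewrite coef_Finv//.
apply: (@finite_energy_le _ _ _ ((`|u| / C%:num) ^+ 2)) => s us.
have us' : uniq [seq - K | K <- s] by rewrite map_inj_uniq//; exact: oppr_inj.
apply: le_trans (sum_le_norm u us'); rewrite big_map; apply: ler_sum => J _.
by rewrite /= Rcomplex_norm_conj /weight mulrNz sqrrN.
Qed.

Lemma norm_conjH u : `|conjH u| = `|u|.
Proof.
have le v : `|conjH v| <= `|v|.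
  apply: norm_le_sum => // s us.
  have us' : uniq [seq - K | K <- s] by rewrite map_inj_uniq//; exact: oppr_inj.
  apply: le_trans (sum_le_norm v us'); rewrite big_map; apply: ler_sum => J _.
  by rewrite coef_conjH Rcomplex_norm_conj /weight mulrNz sqrrN.
apply/eqP; rewrite eq_le le /=.
rewrite [leLHS](_ : _ = `|conjH (conjH u)|) ?le//; congr (`|_|).
by apply: coef_inj => K; rewrite !coef_conjH opprK conjcK.
Qed.

Lemma Heval_conjH u (x : R) : conjH u x = conjc (u x).
Proof.
apply: zconv_zseries; apply: eq_zconv (zconv_conj (zconv_Heval u x)) => K.
rewrite coef_conjH conjcM conj_cis; congr (_ * cis _).
by rewrite mulrNz !(mulrN, mulNr) opprK.
Qed.

End evaluation.

Section pointwise_product.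
Context (R : realType) (L l : R) (C : {posnum R}).
Hypotheses (L_gt0 : 0 < L) (C_large : admissible_norm L l C).
Local Notation H := (Hper L l C).
Implicit Types (u v w : H) (y z : Rcomplex R).

Lemma Heval_sum (I : Type) (s : seq I) (F : I -> H) (x : R) :
  (\sum_(i <- s) F i) x = \sum_(i <- s) F i x.
Proof.
elim: s => [|i s IH]; first by rewrite !big_nil Heval0.
by rewrite !big_cons HevalD// IH.
Qed.

Definition is_prod u v w := forall x, w x = u x * v x.

Lemma is_prodDl u1 u2 v w1 w2 :
  is_prod u1 v w1 -> is_prod u2 v w2 -> is_prod (u1 + u2) v (w1 + w2).
Proof. by move=> w1E w2E x; rewrite !HevalD// w1E w2E mulrDl. Qed.

Lemma is_prodNl u v w : is_prod u v w -> is_prod (- u) v (- w).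
Proof. by move=> wE x; rewrite !HevalN// wE mulNr. Qed.

Lemma is_prodC u v w : is_prod u v w -> is_prod v u w.
Proof. by move=> wE x; rewrite wE mulrC. Qed.

Lemma norm_is_prod u v w : is_prod u v w -> `|w| <= `|u| * `|v|.
Proof. by have [+ _] := C_large; exact. Qed.

Lemma is_prod_mono K J y z :
  is_prod (mono K y) (mono J z) (mono (K + J) (y * z)).
Proof.
move=> x; rewrite !Heval_mono// intrD mulrDr !mulrDl cisD.
by rewrite !mulrA; congr (_ * _); rewrite -!mulrA; congr (_ * _); rewrite mulrC.
Qed.

Lemma is_prod_sum (I J : Type) (r : seq I) (s : seq J) (F : I -> H) (G : J -> H)
    (W : I -> J -> H) :
  (forall i j, is_prod (F i) (G j) (W i j)) ->
  is_prod (\sum_(i <- r) F i) (\sum_(j <- s) G j)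
    (\sum_(i <- r) \sum_(j <- s) W i j).
Proof.
move=> FG x; rewrite !Heval_sum mulr_suml; apply: eq_bigr => i _.
by rewrite Heval_sum mulr_sumr; apply: eq_bigr => j _; rewrite FG.
Qed.

Lemma trunc_cauchy u e : 0 < e -> exists N, forall m n, (N <= m)%N ->
  (N <= n)%N -> `|trunc (zr m) u - trunc (zr n) u| <= e.
Proof.
move=> e0; have e2 : 0 < e / 2 by rewrite divr_gt0.
have /cvg_seqP/(_ _ e2)[N uN] := @trunc_cvg R L l C u.
exists N => m n /uN um /uN un; rewrite -(subrKA u).
by apply: le_trans (ler_normD _ _) _; rewrite (distrC u); lra.
Qed.

Lemma is_prod_exists u v : exists w, is_prod u v w.
Proof.
pose p n := trunc (zr n) u; pose q n := trunc (zr n) v.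
have pq (nm : nat * nat) : exists w, is_prod (p nm.1) (q nm.2) w.
  by eexists; apply: is_prod_sum => K J; exact: is_prod_mono.
have [w wE] := choice pq.
have pu n : `|p n| <= `|u| by apply: norm_trunc_le; exact: zr_uniq.
have qv n : `|q n| <= `|v| by apply: norm_trunc_le; exact: zr_uniq.
pose M := `|u| + `|v| + 1.
have M0 : 0 < M by rewrite ltr_wpDl ?addr_ge0.
have uM : `|u| <= M by rewrite /M -addrA lerDl addr_ge0.
have vM : `|v| <= M by rewrite /M addrAC lerDr addr_ge0.
have e2M e : 0 < e -> 0 < e / (2 * M) by move=> e0; rewrite divr_gt0// mulr_gt0.
have ME e : M * (e / (2 * M)) + M * (e / (2 * M)) = e.
  by field; rewrite gt_eqF.
have [e e0|w0 ww0] := Hper_seq_complete (u := fun n => w (n, n)).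
  have [N1 pN] := trunc_cauchy u (e2M _ e0).
  have [N2 qN] := trunc_cauchy v (e2M _ e0).
  exists (maxn N1 N2) => m n; rewrite !geq_max => /andP[m1 m2] /andP[n1 n2].
  rewrite -(subrKA (w (m, n))) -(ME e); apply: le_trans (ler_normD _ _) _.
  apply: lerD.
    apply: (@le_trans _ _ (`|p m| * `|q m - q n|)).
      apply: norm_is_prod; apply/is_prodC/is_prodDl.
        exact/is_prodC/(wE (m, m)).
      exact/is_prodNl/is_prodC/(wE (m, n)).
    by apply: ler_pM => //; [exact: le_trans (pu m) uM|exact: qN].
  apply: (@le_trans _ _ (`|p m - p n| * `|q n|)).
    apply: norm_is_prod; apply/is_prodDl; first exact/(wE (m, n)).
    exact/is_prodNl/(wE (n, n)).
  by rewrite mulrC; apply: ler_pM => //; [exact: le_trans (qv n) vM|exact: pN].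
exists w0 => x; apply/eqP; rewrite -subr_eq0 -normr_le0.
apply/ler_addgt0Pl => e e0; rewrite addr0.
have e3M : 0 < e / (3 * M) by rewrite divr_gt0// mulr_gt0.
have e3 : 0 < e / 3 by rewrite divr_gt0.
have /cvg_seqP/(_ _ e3)[N1 wN] := ww0.
have /cvg_seqP/(_ _ e3M)[N2 pN] := @trunc_cvg R L l C u.
have /cvg_seqP/(_ _ e3M)[N3 qN] := @trunc_cvg R L l C v.
pose n := maxn N1 (maxn N2 N3).
have wn : `|w0 x - w (n, n) x : Rcomplex R| <= e / 3.
  rewrite -HevalN// -HevalD//; apply: le_trans (Heval_norm_le _ _ _ _) _ => //.
  by rewrite distrC wN ?leq_maxl.
have pn : `|p n x - u x : Rcomplex R| <= e / (3 * M).
  rewrite -HevalN// -HevalD//; apply: le_trans (Heval_norm_le _ _ _ _) _ => //.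
  by rewrite pN// /n maxnCA leq_maxl.
have qn : `|q n x - v x : Rcomplex R| <= e / (3 * M).
  rewrite -HevalN// -HevalD//; apply: le_trans (Heval_norm_le _ _ _ _) _ => //.
  by rewrite qN// /n maxnA leq_maxr.
have -> : w0 x - u x * v x = (w0 x - w (n, n) x) +
    (p n x * (q n x - v x) + (p n x - u x) * v x).
  by rewrite (wE (n, n)) /=; ring.
apply: le_trans (ler_normD _ _) _.
have -> : e = e / 3 + (M * (e / (3 * M)) + e / (3 * M) * M).
  by field; rewrite gt_eqF.
apply: lerD => //; apply: le_trans (ler_normD _ _) _; apply: lerD.
  rewrite norm_mulC; apply: ler_pM => //.
  apply: le_trans (Heval_norm_le _ _ _ _) _ => //.
  exact: le_trans (pu n) uM.
rewrite norm_mulC; apply: ler_pM => //.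
by apply: le_trans (Heval_norm_le _ _ _ _) _.
Qed.

Definition mulH u v : H := xget 0 [set w : H | is_prod u v w].

Lemma HevalM u v (x : R) : mulH u v x = u x * v x.
Proof.
exact: (xgetPex (0 : H) (is_prod_exists u v)).
Qed.

Lemma mulH_eq u v w : is_prod u v w -> mulH u v = w.
Proof.
by move=> wE; apply: (Heval_inj L_gt0 C_large) => x; rewrite HevalM wE.
Qed.

Lemma norm_mulH u v : `|mulH u v| <= `|u| * `|v|.
Proof. by apply: norm_is_prod => x; exact: HevalM. Qed.

Lemma mulHBl u1 u2 v : mulH (u1 - u2) v = mulH u1 v - mulH u2 v.
Proof.
apply: mulH_eq; apply: is_prodDl; first exact: HevalM.
by apply: is_prodNl; exact: HevalM.
Qed.

Lemma mulHC u v : mulH u v = mulH v u.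
Proof. by apply: mulH_eq => x; rewrite HevalM mulrC. Qed.

Lemma mulHBr u v1 v2 : mulH u (v1 - v2) = mulH u v1 - mulH u v2.
Proof. by rewrite mulHC mulHBl !(mulHC u). Qed.

Lemma conjHB u v : conjH (u - v) = conjH u - conjH v.
Proof.
by apply: coef_inj => K; rewrite Hper_coefD Hper_coefN !coef_conjH -raddfB.
Qed.

Lemma cubicE u : cubic u = mulH u (mulH u (conjH u)).
Proof.
have uE : is_prod u (mulH u (conjH u)) (mulH u (mulH u (conjH u))).
  exact: HevalM.
have cE x : cubic u x = `|u x| ^+ 2 *: u x.
  suff /(xgetPex (0 : H)) :
    exists w : H, forall x, w x = `|u x| ^+ 2 *: u x by exact.
  exists (mulH u (mulH u (conjH u))) => y.
  by rewrite !HevalM Heval_conjH// mulC_conj scaleC_mul mulrC.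
apply: (Heval_inj L_gt0 C_large) => x.
by rewrite cE !HevalM Heval_conjH// mulC_conj scaleC_mul mulrC.
Qed.

Lemma norm_cubicB u v (M : R) : `|u| <= M -> `|v| <= M ->
  `|cubic u - cubic v| <= 3 * M ^+ 2 * `|u - v|.
Proof.
move=> uM vM; have M0 : 0 <= M by apply: le_trans uM.
rewrite !cubicE.
have -> : mulH u (mulH u (conjH u)) - mulH v (mulH v (conjH v)) =
    mulH (u - v) (mulH u (conjH u)) + (mulH v (mulH (u - v) (conjH u)) +
    mulH v (mulH v (conjH (u - v)))).
  by rewrite conjHB !(mulHBl, mulHBr) !addrA !subrK.
have -> : 3 * M ^+ 2 * `|u - v| = `|u - v| * (M * M) +
    (M * (`|u - v| * M) + M * (M * `|u - v|)) by ring.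
have mul_le a b (x y : R) : `|a| <= x -> `|b| <= y -> `|mulH a b| <= x * y.
  by move=> ax bY; apply: le_trans (norm_mulH _ _) _; exact: ler_pM.
apply: le_trans (ler_normD _ _) _; apply: lerD.
  by do 2![apply: (mul_le) => //]; rewrite norm_conjH.
apply: le_trans (ler_normD _ _) _; apply: lerD;
  by do 2![apply: (mul_le) => //]; rewrite norm_conjH.
Qed.

End pointwise_product.

(** * The Schroedinger group and the cubic term *)

Section schroedinger_group.
Context (R : realType) (L l : R) (C : {posnum R}).
Local Notation H := (Hper L l C).
Local Notation S := (@schroedinger R L l C).
Implicit Types (u v w : H) (z : Rcomplex R).

Lemma coef_schroedinger t u K :
  coef (S t u) K = cis (- (t * wavenumber (L := L) K ^+ 2)) * coef u K.
Proof.
rewrite coef_Finv//; apply: (@finite_energy_coef _ L _ C _ u) => J.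
by rewrite norm_mulC norm_cis mul1r.
Qed.

Lemma norm_schroedinger t u : `|S t u| = `|u|.
Proof.
by apply/eqP; rewrite eq_le; apply/andP; split; apply: norm_le_coef => K;
  rewrite coef_schroedinger norm_mulC norm_cis mul1r.
Qed.

Lemma schroedingerD t u v : S t (u + v) = S t u + S t v.
Proof.
apply: coef_inj => K.
by rewrite Hper_coefD !coef_schroedinger Hper_coefD mulrDr.
Qed.

Lemma schroedingerN t u : S t (- u) = - S t u.
Proof.
apply: coef_inj => K.
by rewrite Hper_coefN !coef_schroedinger Hper_coefN mulrN.
Qed.

Lemma schroedinger_add s t u : S (s + t) u = S s (S t u).
Proof.
apply: coef_inj => K; rewrite !coef_schroedinger mulrA -cisD.
by rewrite -opprD -mulrDl.
Qed.

Lemma schroedinger_sum t (I : Type) (s : seq I) (F : I -> H) :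
  S t (\sum_(i <- s) F i) = \sum_(i <- s) S t (F i).
Proof.
apply: coef_inj => K; rewrite coef_schroedinger !Hper_coef_sum mulr_sumr.
by apply: eq_bigr => i _; rewrite coef_schroedinger.
Qed.

Lemma schroedinger_mono t K z : S t (mono K z) =
  mono K (cis (- (t * wavenumber (L := L) K ^+ 2)) * z).
Proof.
apply: coef_inj => J; rewrite coef_schroedinger !coef_mono.
by case: eqP => [->//|_]; rewrite mulr0.
Qed.

Lemma dist_schroedinger s t u : `|S s u - S t u| = `|S (s - t) u - u|.
Proof.
have -> : S s u = S t (S (s - t) u) by rewrite -schroedinger_add addrC subrK.
by rewrite -schroedingerN -schroedingerD norm_schroedinger.
Qed.

(* [del] depends only on the modes [F i] and the bounds [B i], not on [g]. *)
Lemma schroedinger_mono_unif (I : Type) (r : seq I) (F : I -> int)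
    (B : I -> R) e :
  0 < e -> exists2 del, 0 < del & forall h, `|h| <= del ->
  forall g : I -> Rcomplex R, (forall i, `|mono (F i) (g i) : H| <= B i) ->
    `|S h (\sum_(i <- r) mono (F i) (g i)) -
      \sum_(i <- r) mono (F i) (g i)| <= e.
Proof.
elim: r e => [|i r IH] e e0.
  exists 1 => // h _ g _.
  by rewrite schroedinger_sum !big_nil subrr normr0 ltW.
have e2 : 0 < e / 2 by rewrite divr_gt0.
have B1 : 0 < `|B i| + 1 by rewrite ltr_wpDl.
have k1 : 0 < wavenumber (L := L) (F i) ^+ 2 + 1 by rewrite ltr_wpDl ?sqr_ge0.
have [d1 d10 hd1] := IH _ e2.
have [d2 d20 hd2] := cis_continuous0 (divr_gt0 e2 B1).
exists (Num.min d1 (d2 / (wavenumber (L := L) (F i) ^+ 2 + 1))).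
  by rewrite lt_min d10 divr_gt0.
move=> h; rewrite le_min => /andP[h1 h2] g gB; rewrite big_cons.
set p := \sum_(j <- r) _.
have -> : S h (mono (F i) (g i) + p) - (mono (F i) (g i) + p) =
    (S h (mono (F i) (g i)) - mono (F i) (g i)) + (S h p - p).
  by rewrite schroedingerD opprD addrACA.
apply: le_trans (ler_normD _ _) _.
rewrite [leRHS](splitr e) lerD//; last exact: hd1.
rewrite schroedinger_mono -[X in _ - mono _ X]mul1r -monoB -mulrBl.
rewrite norm_mono_mul.
apply: (@le_trans _ _ (e / 2 / (`|B i| + 1) * (`|B i| + 1))).
  apply: ler_pM => //; last first.
    by apply: le_trans (gB i) _; apply: le_trans (ler_norm _) _; rewrite lerDl.
  apply: hd2; rewrite normrN normrM [X in _ * X]ger0_norm ?sqr_ge0//.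
  move: h2; rewrite ler_pdivlMr// => h2; apply: le_trans h2.
  by rewrite ler_wpM2l ?normr_ge0// lerDl ler01.
by rewrite divfK// gt_eqF.
Qed.

Lemma schroedinger_cvg0 u e : 0 < e ->
  exists2 del, 0 < del & forall h, `|h| <= del -> `|S h u - u| <= e.
Proof.
move=> e0; have e3 : 0 < e / 3 by rewrite divr_gt0.
have /cvg_seqP/(_ _ e3)[N uN] := @trunc_cvg R L l C u.
set p := trunc (zr N) u in uN.
have [d d0 hd] := @schroedinger_mono_unif _ (zr N) id
  (fun K => `|mono K (coef u K) : H|) _ e3.
exists d => // h /hd/(_ (coef u))/(_ (fun=> lexx _)) => hp.
have -> : S h u - u = (S h p - p) + (S h (u - p) + (p - u)).
  by rewrite schroedingerD schroedingerN addrCA !subrKA.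
apply: le_trans (ler_normD _ _) _.
apply: (@le_trans _ _ (e / 3 + (e / 3 + e / 3))).
  apply: lerD => //; apply: le_trans (ler_normD _ _) _.
  by rewrite norm_schroedinger distrC lerD// uN.
by rewrite le_eqVlt; apply/orP; left; apply/eqP; field.
Qed.

End schroedinger_group.

Lemma dist_chain (R : realType) (V : normedModType R) (a b c d : V)
    (x y z : R) :
  `|a - b| <= x -> `|b - c| <= y -> `|c - d| <= z -> `|a - d| <= x + y + z.
Proof.
move=> ab bc cd; apply: le_trans (ler_distD c a d) _; rewrite lerD//.
by apply: le_trans (ler_distD b a c) _; rewrite lerD.
Qed.

Section duhamel_integrand.
Context (R : realType) (L l : R) (C : {posnum R}).
Hypotheses (L_gt0 : 0 < L) (C_large : admissible_norm L l C).
Local Notation H := (Hper L l C).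
Local Notation S := (@schroedinger R L l C).
Implicit Types (u v w : H) (z : Rcomplex R).

Lemma conjH_mono K z : conjH (mono K z : H) = mono (- K) (conjc z).
Proof.
apply: coef_inj => J; rewrite coef_conjH !coef_mono eqr_oppLR.
by case: eqP => // _; rewrite raddf0.
Qed.

Lemma conjH_sum (I : Type) (s : seq I) (F : I -> H) :
  conjH (\sum_(i <- s) F i) = \sum_(i <- s) conjH (F i).
Proof.
apply: coef_inj => K; rewrite coef_conjH !Hper_coef_sum raddf_sum.
by apply: eq_bigr => i _; rewrite coef_conjH.
Qed.

Lemma mulH_sum (I J : Type) (r : seq I) (s : seq J) (F : I -> int)
    (G : J -> int) (f : I -> Rcomplex R) (g : J -> Rcomplex R) :
  mulH (\sum_(i <- r) mono (F i) (f i) : H) (\sum_(j <- s) mono (G j) (g j)) =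
  \sum_(ij <- [seq (i, j) | i <- r, j <- s])
    mono (F ij.1 + G ij.2) (f ij.1 * g ij.2).
Proof.
apply: mulH_eq => //; rewrite big_allpairs; apply: is_prod_sum => // i j /=.
exact: is_prod_mono.
Qed.

Definition triples (s : seq int) : seq (int * (int * int)) :=
  [seq (i, jk) | i <- s, jk <- [seq (j, k) | j <- s, k <- s]].

Lemma cubic_sum_mono (s : seq int) (f : int -> Rcomplex R) :
  cubic (\sum_(K <- s) mono K (f K) : H) =
  \sum_(t <- triples s) mono (t.1 + (t.2.1 - t.2.2))
    (f t.1 * (f t.2.1 * conjc (f t.2.2))).
Proof.
rewrite cubicE// conjH_sum.
under [X in mulH _ (mulH _ X)]eq_bigr do rewrite conjH_mono.
by rewrite (mulH_sum _ _ id -%R f (conjc \o f))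
  (mulH_sum _ _ id (fun t => t.1 - t.2) f (fun t => f t.1 * conjc (f t.2))).
Qed.

Definition duhamel u (tau s : R) : H := S (tau - s) (cubic (S s u)).

Lemma norm_duhamel u tau s : `|duhamel u tau s| <= `|u| ^+ 3.
Proof.
rewrite norm_schroedinger cubicE//; apply: le_trans (norm_mulH _ _ _ _) _ => //.
rewrite exprS expr2 norm_schroedinger ler_wpM2l//.
apply: le_trans (norm_mulH _ _ _ _) _ => //.
by rewrite norm_conjH norm_schroedinger.
Qed.

Lemma dist_duhamel u v (M tau s : R) : `|u| <= M -> `|v| <= M ->
  `|duhamel u tau s - duhamel v tau s| <= 3 * M ^+ 2 * `|u - v|.
Proof.
move=> uM vM; rewrite /duhamel -schroedingerN -schroedingerD norm_schroedinger.
apply: le_trans (norm_cubicB L_gt0 C_large (M := M) _ _) _;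
  rewrite ?norm_schroedinger//.
by rewrite -schroedingerN -schroedingerD norm_schroedinger.
Qed.

Lemma duhamel_trunc_unif (N : nat) u (e : R) : 0 < e ->
  exists2 del, 0 < del & forall tau s tau' s',
    `|tau - tau'| <= del -> `|s - s'| <= del ->
    `|duhamel (trunc (zr N) u) tau s - duhamel (trunc (zr N) u) tau' s'| <= e.
Proof.
move=> e0; set p := trunc _ u.
have e2 : 0 < e / 2 by rewrite divr_gt0.
have M0 : 0 < 3 * `|p| ^+ 2 + 1 by rewrite ltr_wpDl// mulr_ge0// sqr_ge0.
have [d1 d10 hd1] := schroedinger_cvg0 p (divr_gt0 e2 M0).
have [d2 d20 hd2] := @schroedinger_mono_unif R L l C _ (triples (zr N))
  (fun t => t.1 + (t.2.1 - t.2.2))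
  (fun t => `|coef u t.1| * (`|coef u t.2.1| * `|coef u t.2.2|) *
            `|mono (t.1 + (t.2.1 - t.2.2)) 1 : H|) _ e2.
exists (Num.min d1 (d2 / 2)); first by rewrite lt_min d10 divr_gt0.
move=> tau s tau' s'; rewrite !le_min => /andP[_ t2] /andP[s1 s2].
set q := cubic (S s' p).
have -> : duhamel p tau s - duhamel p tau' s' =
    (S (tau - s) (cubic (S s p)) - S (tau - s) q) +
    (S (tau - s) q - S (tau' - s') q) by rewrite subrKA.
apply: le_trans (ler_normD _ _) _; rewrite [leRHS](splitr e) lerD//.
  rewrite -schroedingerN -schroedingerD norm_schroedinger.
  apply: le_trans (norm_cubicB L_gt0 C_large (M := `|p|) _ _) _;
    rewrite ?norm_schroedinger// dist_schroedinger.
  apply: (@le_trans _ _ (3 * `|p| ^+ 2 * (e / 2 / (3 * `|p| ^+ 2 + 1)))).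
    by rewrite ler_wpM2l ?hd1// mulr_ge0// sqr_ge0.
  rewrite mulrA ler_pdivrMr// mulrC ler_wpM2l ?(ltW e2)//.
  by rewrite lerDl ler01.
have -> : q = \sum_(t <- triples (zr N)) mono (t.1 + (t.2.1 - t.2.2))
    (let f K := cis (- (s' * wavenumber (L := L) K ^+ 2)) * coef u K in
     f t.1 * (f t.2.1 * conjc (f t.2.2))).
  rewrite /q /p /trunc schroedinger_sum.
  by under eq_bigr do rewrite schroedinger_mono; rewrite cubic_sum_mono.
rewrite dist_schroedinger; apply: hd2.
  have -> : tau - s - (tau' - s') = (tau - tau') - (s - s') by ring.
  by apply: le_trans (ler_normB _ _) _; lra.
move=> t; rewrite -[X in mono _ X]mulr1 norm_mono_mul ler_wpM2r//.
by rewrite !norm_mulC Rcomplex_norm_conj !norm_mulC !norm_cis !mul1r.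
Qed.

Lemma duhamel_unif u (e : R) : 0 < e ->
  exists2 del, 0 < del & forall v tau s tau' s', `|v - u| <= del ->
    `|tau - tau'| <= del -> `|s - s'| <= del ->
    `|duhamel v tau s - duhamel u tau' s'| <= e.
Proof.
move=> e0; pose M := `|u| + 2; pose A := 3 * M ^+ 2.
have M0 : 0 < M by rewrite ltr_wpDl.
have A0 : 0 < A by rewrite mulr_gt0// exprn_gt0.
have [eta eta0 [eta1 Aeta]] :
    exists2 eta, 0 < eta & eta <= 1 /\ A * eta <= e / 6.
  exists (Num.min 1 (e / (6 * A))).
    by rewrite lt_min ltr01 divr_gt0// mulr_gt0.
  split; first by rewrite ge_min lexx.
  apply: (@le_trans _ _ (A * (e / (6 * A)))).
    by rewrite ler_wpM2l ?(ltW A0)// ge_min lexx orbT.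
  by rewrite le_eqVlt; apply/orP; left; apply/eqP; field; rewrite gt_eqF.
have /cvg_seqP/(_ _ eta0)[N /(_ N (leqnn N)) pu] := @trunc_cvg R L l C u.
have e2 : 0 < e / 2 by rewrite divr_gt0.
have [d d0 hd] := duhamel_trunc_unif N u e2.
set p := trunc _ u in pu hd.
exists (Num.min eta d); first by rewrite lt_min eta0.
move=> v tau s tau' s'; rewrite !le_min => /andP[vu _] /andP[_ t1] /andP[_ s1].
have pM : `|p| <= M.
  rewrite -(subrK u p) /M addrC; apply: le_trans (ler_normD _ _) _.
  by rewrite lerD2l (le_trans pu)// (le_trans eta1)// ler1n.
have vM : `|v| <= M.
  rewrite -(subrK u v) /M addrC; apply: le_trans (ler_normD _ _) _.
  by rewrite lerD2l (le_trans vu)// (le_trans eta1)// ler1n.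
have uM : `|u| <= M by rewrite lerDl.
have vp : `|v - p| <= eta + eta.
  apply: le_trans (ler_distD u v p) _; apply: lerD; first exact: vu.
  rewrite distrC; exact: pu.
have h1 : `|duhamel v tau s - duhamel p tau s| <= A * (eta + eta).
  apply: le_trans (dist_duhamel _ _ vM pM) _.
  by apply: ler_wpM2l; [exact: ltW|exact: vp].
have h2 : `|duhamel p tau' s' - duhamel u tau' s'| <= A * eta.
  apply: le_trans (dist_duhamel _ _ pM uM) _.
  by apply: ler_wpM2l; [exact: ltW|exact: pu].
have h3 := hd _ _ _ _ t1 s1.
apply: le_trans (dist_chain h1 h3 h2) _.
by rewrite mulrDr; clear - Aeta; lra.
Qed.

End duhamel_integrand.

Section roots_of_unity.
Context (R : realType).

Lemma cis_neq1 (x : R) : 0 < x < 2 * pi -> cis x != 1.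
Proof.
move=> /andP[x0 x2]; apply/eqP => -[cx _].
have hx : 0 < x / 2 < pi by rewrite divr_gt0//= ltr_pdivrMr// mulrC.
have := sin_gt0_pi hx; suff /eqP -> : sin (x / 2) == 0 by rewrite ltxx.
rewrite -sqrf_eq0; have := cosD (x / 2) (x / 2).
rewrite -splitr cx -!expr2; have := cos2Dsin2 (x / 2) => h1 h2.
by apply/eqP; lra.
Qed.

Lemma sum_cis (n : nat) (m : int) : (absz m <= n)%N ->
  \sum_(i < n.+1) cis (i%:R * (2 * pi * m%:~R / n.+1%:R)) =
  (if m == 0 then n.+1%:R else 0) :> Rcomplex R.
Proof.
move=> mn; case: eqP => [->|/eqP m0].
  under eq_bigr do rewrite mulr0 mul0r mulr0 cis0.
  by rewrite sumr_const card_ord.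
set x := 2 * pi * m%:~R / n.+1%:R.
have x1 : cis x != 1.
  have pos (k : nat) : (0 < k)%N -> (k <= n)%N ->
      cis (2 * pi * k%:R / n.+1%:R) != 1 :> Rcomplex R.
    move=> k0 kn; apply: cis_neq1; rewrite !mulr_gt0 ?pi_gt0 ?ltr0n//=.
    rewrite ltr_pdivrMr ?ltr0n// ltr_pM2l ?mulr_gt0 ?pi_gt0//.
    by rewrite ltr_nat.
  case: m m0 mn @x => k k0 kn.
    by apply: pos => //; rewrite lt0n.
  rewrite NegzE /= mulrNz mulrN mulNr -conj_cis.
  apply: contra_neq (pos k.+1 isT kn) => e.
  by rewrite -[LHS]conjcK [conjc (cis _)]e rmorph1.
under eq_bigr do rewrite -cisX.
apply: (mulfI (x := cis x - 1)); first by rewrite subr_eq0.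
rewrite -subrX1 cisX mulr0 mulrC divfK ?pnatr_eq0//.
by rewrite mulrC cis_int_period subrr.
Qed.

End roots_of_unity.

Section resonances.
Context (R : realType) (L l : R) (C : {posnum R}).
Hypotheses (L_gt0 : 0 < L) (C_large : admissible_norm L l C).
Local Notation H := (Hper L l C).
Local Notation S := (@schroedinger R L l C).
Local Notation tauP := (L ^+ 2 / (2 * pi)).
Implicit Types (u v w : H) (z : Rcomplex R).

(* [K1 - K3] and [K2 - K3] are the factors of
   [(K1 + K2 - K3)^2 - K1^2 - K2^2 + K3^2], up to the factor 2. *)
Definition resonance (t : int * (int * int)) : int :=
  2 * ((t.1 - t.2.2) * (t.2.1 - t.2.2)).

Lemma period_wavenumber (x : R) (K : int) :
  x * tauP * wavenumber (L := L) K ^+ 2 = x * (2 * pi) * (K ^+ 2)%:~R.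
Proof.
rewrite /wavenumber rmorphXn /=; move: (@pi R) (pi_gt0 R) => p p0.
by field; rewrite (gt_eqF L_gt0) (gt_eqF p0).
Qed.

Lemma duhamel_trig (s : seq int) (f : int -> Rcomplex R) (x : R) :
  duhamel (\sum_(K <- s) mono K (f K) : H) tauP (x * tauP) =
  \sum_(t <- triples s) mono (t.1 + (t.2.1 - t.2.2))
    (cis (x * (2 * pi * (resonance t)%:~R)) *
       (f t.1 * (f t.2.1 * conjc (f t.2.2)))).
Proof.
rewrite /duhamel schroedinger_sum.
under eq_bigr do rewrite schroedinger_mono period_wavenumber.
rewrite cubic_sum_mono// schroedinger_sum; apply: eq_bigr => -[K1 [K2 K3]] _ /=.
rewrite schroedinger_mono; congr mono.
have -> : tauP - x * tauP = (1 - x) * tauP by rewrite mulrBl mul1r.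
rewrite period_wavenumber.
set K := K1 + (K2 - K3).
rewrite conjcM conj_cis.
have -> : cis (- ((1 - x) * (2 * pi) * (K ^+ 2)%:~R)) =
    cis (x * (2 * pi) * (K ^+ 2)%:~R) :> Rcomplex R.
  rewrite -[RHS]mul1r -(cis_int_period R (- K ^+ 2)) -cisD; congr cis.
  by rewrite rmorphN /=; move: (@pi R) => p; ring.
have -> : x * (2 * pi * (resonance (K1, (K2, K3)))%:~R) =
  x * (2 * pi) * (K ^+ 2)%:~R + (- (x * (2 * pi) * (K1 ^+ 2)%:~R) +
  (- (x * (2 * pi) * (K2 ^+ 2)%:~R) + x * (2 * pi) * (K3 ^+ 2)%:~R)).
  rewrite /resonance /K /= !(rmorphXn, rmorphM, rmorphB, rmorphD) /=.
  by move: (@pi R) => p; ring.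
rewrite !cisD opprK; ring.
Qed.

Lemma sum_or2 (V : zmodType) (s : seq int) (h : int -> V) (K1 K2 : int) :
  uniq s -> K1 \in s -> K2 \in s ->
  \sum_(K <- s) (if (K1 == K) || (K2 == K) then h K else 0) =
  h K1 + h K2 - (if K1 == K2 then h K1 else 0).
Proof.
move=> us K1s K2s.
rewrite (bigD1_seq K1)//= eqxx /=; case: (eqVneq K1 K2) => [<-|K12].
  rewrite big1 ?addr0 ?addrK// => K KK1.
  by rewrite orbb eq_sym (negbTE KK1).
rewrite subr0; congr (_ + _); rewrite -big_filter (bigD1_seq K2)/=; last first.
- exact: filter_uniq.
- by rewrite mem_filter eq_sym K12.
rewrite eqxx orbT -big_filter big1_seq ?addr0// => K /=.
rewrite !mem_filter => /and3P[KK2 KK1 _].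
by rewrite ![_ == K]eq_sym (negbTE KK1) (negbTE KK2).
Qed.

Lemma riemann_sum_trunc u (N : nat) : exists n0, forall n, (n0 <= n)%N ->
  riemann_sum (duhamel (trunc (zr N) u) tauP) tauP n =
  tauP *: ((2 * \sum_(K <- zr N) `|coef u K| ^+ 2) *: trunc (zr N) u -
    \sum_(K <- zr N) mono K (`|coef u K| ^+ 2 *: coef u K)).
Proof.
pose f := coef u; set s := zr N.
pose h (K1 K2 K3 : int) : H :=
  mono (K1 + (K2 - K3)) (f K1 * (f K2 * conjc (f K3))).
exists (\max_(t <- triples s) absz (resonance t))%N => n n0n.
rewrite /riemann_sum.
have -> : \sum_(i < n.+1) duhamel (trunc s u) tauP (i%:R * (tauP / n.+1%:R)) =
    n.+1%:R *: \sum_(t <- triples s)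
      (if resonance t == 0 then h t.1 t.2.1 t.2.2 else 0).
  under eq_bigr => i _.
    rewrite (_ : i%:R * (tauP / n.+1%:R) = i%:R / n.+1%:R * tauP); last by ring.
    rewrite duhamel_trig.
    over.
  rewrite exchange_big scaler_sumr; apply: eq_big_seq => t ts /=.
  rewrite -mono_sum -mulr_suml.
  under eq_bigr do rewrite mulrAC -mulrA.
  rewrite sum_cis; last first.
    by apply: leq_trans n0n; rewrite (big_rem t)//= leq_maxl.
  case: eqP => _; last first.
    rewrite mul0r scaler0; apply: coef_inj => K.
    by rewrite coef_mono; case: eqP.
  rewrite -monoZ; congr mono.
  by rewrite mulr_natl scaler_nat.
rewrite scalerA divfK ?pnatr_eq0//; congr (_ *: _).
rewrite /triples big_allpairs.
under eq_bigr do rewrite big_allpairs.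
under eq_big_seq => K1 K1s.
  under eq_big_seq => K2 K2s.
    under eq_bigr do rewrite /resonance /= mulf_eq0/= mulf_eq0 !subr_eq0.
    rewrite (sum_or2 (h K1 K2))//; last exact: zr_uniq.
    over.
  rewrite sumrB big_split /=.
  over.
rewrite sumrB big_split/=.
have h1 K1 K2 : h K1 K2 K1 = `|f K1| ^+ 2 *: mono K2 (f K2).
  rewrite /h addrC subrK mulrCA mulC_conj -monoZ; congr mono.
  by rewrite scaleC_mul mulrC.
have h2 K1 K2 : h K1 K2 K2 = `|f K2| ^+ 2 *: mono K1 (f K1).
  rewrite /h subrr addr0 mulC_conj -monoZ; congr mono.
  by rewrite scaleC_mul mulrC.
have sum1 : \sum_(i <- s) \sum_(j <- s) h i j i =
    (\sum_(K <- s) `|f K| ^+ 2) *: trunc s u.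
  rewrite scaler_suml; apply: eq_bigr => i _; rewrite /trunc scaler_sumr.
  by apply: eq_bigr => j _; rewrite h1.
have sum2 : \sum_(i <- s) \sum_(j <- s) h i j j =
    (\sum_(K <- s) `|f K| ^+ 2) *: trunc s u.
  rewrite exchange_big -sum1; apply: eq_bigr => i _; apply: eq_bigr => j _.
  by rewrite h1 h2.
rewrite sum1 sum2 mulr_natl mulr2n scalerDl; congr (_ - _).
apply: eq_big_seq => K Ks; rewrite (bigD1_seq K) ?zr_uniq//= eqxx big1 ?addr0.
  by rewrite h1 monoZ.
by move=> J JK; rewrite eq_sym (negbTE JK).
Qed.
End resonances.

Lemma riemann_sum_dist (R : realType) (V : normedModType R) (f g : R -> V)
    (t t' e M : R) (n : nat) : 0 <= t' ->
  (forall r, 0 <= r <= 1 -> `|f (r * t) - g (r * t')| <= e) ->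
  (forall s, `|f s| <= M) ->
  `|riemann_sum f t n - riemann_sum g t' n| <= `|t - t'| * M + t' * e.
Proof.
move=> t0 fg fM; rewrite /riemann_sum; set N : R := n.+1%:R.
have N0 : 0 < N by rewrite ltr0n.
have sumM (F : 'I_n.+1 -> V) x : (forall i, `|F i| <= x) ->
    `|\sum_(i < n.+1) F i| <= x * N.
  move=> Fx; apply: le_trans (ler_norm_sum _ _ _) _.
  apply: le_trans (ler_sum _ (fun i _ => Fx i)) _.
  by rewrite sumr_const card_ord mulr_natr.
set sf := \sum_(i < n.+1) _; set sg := \sum_(i < n.+1) _.
have -> : (t / N) *: sf - (t' / N) *: sg =
    ((t - t') / N) *: sf + (t' / N) *: (sf - sg).
  by rewrite scalerBr addrA -scalerDl -mulrDl subrK.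
apply: le_trans (ler_normD _ _) _; apply: lerD.
  rewrite normrZ normrM (gtr0_norm (x := N^-1)) ?invr_gt0// -mulrA ler_wpM2l//.
  by rewrite mulrC ler_pdivrMr//; exact: sumM.
rewrite normrZ normrM (gtr0_norm (x := N^-1)) ?invr_gt0// (ger0_norm t0) -mulrA.
rewrite ler_wpM2l// mulrC ler_pdivrMr// /sf /sg -sumrB; apply: sumM => i.
have nodeE (x : R) : i%:R * (x / N) = i%:R / N * x by rewrite mulrA mulrAC.
rewrite !nodeE; apply: fg; rewrite divr_ge0 ?ler0n ?(ltW N0)//=.
by rewrite ler_pdivrMr// mul1r ler_nat ltnW.
Qed.

Lemma cvg_dist_le (R : realType) (V : normedModType R) (u v : nat -> V)
    (x y : V) (c : R) :
  u n @[n --> \oo] --> x -> v n @[n --> \oo] --> y ->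
  (forall n, `|u n - v n| <= c) -> `|x - y| <= c.
Proof.
move=> /cvg_seqP ux /cvg_seqP vy uvc; apply/ler_addgt0Pr => e e0.
have e2 : 0 < e / 2 by rewrite divr_gt0.
have [N1 uN] := ux _ e2; have [N2 vN] := vy _ e2.
have h1 := uN _ (leq_maxl N1 N2); have h2 := vN _ (leq_maxr N1 N2).
rewrite distrC in h1; apply: le_trans (dist_chain h1 (uvc _) h2) _.
by clear; lra.
Qed.

Section duhamel_integral.
Context (R : realType) (L l : R) (C : {posnum R}).
Hypotheses (L_gt0 : 0 < L) (C_large : admissible_norm L l C).
Local Notation H := (Hper L l C).
Local Notation tauP := (L ^+ 2 / (2 * pi)).
Implicit Types (u v w : H).

Lemma unif_cont_duhamel u tau : unif_cont (duhamel u tau).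
Proof.
move=> e e0; have [d d0 ud] := duhamel_unif L_gt0 C_large u e0.
exists d => // x y xy; apply: ud => //; rewrite subrr normr0; exact: ltW.
Qed.

Lemma duhamel_integral_exists u tau : 0 <= tau ->
  exists I, is_bochner lebesgue_measure `[0, tau]%classic (duhamel u tau) I.
Proof.
move=> tau0; apply: is_bochner_unif_cont => //; first exact: unif_cont_duhamel.
exact: Hper_seq_complete.
Qed.

Lemma duhamel_integral_cont u tau0 e : 0 <= tau0 -> 0 < e ->
  exists2 del, 0 < del & forall v tau I I0, 0 <= tau -> `|v - u| <= del ->
    `|tau - tau0| <= del ->
    is_bochner lebesgue_measure `[0, tau]%classic (duhamel v tau) I ->
    is_bochner lebesgue_measure `[0, tau0]%classic (duhamel u tau0) I0 ->
    `|I - I0| <= e.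
Proof.
move=> tau00 e0; pose M := (`|u| + 1) ^+ 3.
have M0 : 0 < M by rewrite exprn_gt0// ltr_wpDl.
have t1 : 0 < 2 * (tau0 + 1) by rewrite mulr_gt0// ltr_wpDl.
have M2 : 0 < 2 * M by rewrite mulr_gt0.
have [d d0 ud] := duhamel_unif L_gt0 C_large u (divr_gt0 e0 t1).
exists (Num.min (Num.min 1 d) (e / (2 * M))).
  by rewrite !lt_min ltr01 d0 divr_gt0.
move=> v tau I I0 tau_ge0; rewrite !le_min.
move=> /andP[/andP[v1 vd] _] /andP[/andP[_ td] tM] vI uI.
have vI' := is_bochner_riemann tau_ge0 (unif_cont_duhamel v tau) vI.
have uI' := is_bochner_riemann tau00 (unif_cont_duhamel u tau0) uI.
apply: (cvg_dist_le vI' uI') => n.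
apply: le_trans (riemann_sum_dist (M := M) n tau00
  (e := e / (2 * (tau0 + 1))) _ _) _.
- move=> r /andP[r0 r1]; apply: ud => //; rewrite -mulrBr normrM ger0_norm//.
  by apply: le_trans td; rewrite ler_piMl.
- move=> s; apply: le_trans (norm_duhamel L_gt0 C_large _ _ _) _.
  rewrite lerXn2r ?nnegrE ?addr_ge0//; rewrite -(subrK u v) addrC.
  by apply: le_trans (ler_normD _ _) _; rewrite lerD2l.
- rewrite [leRHS](splitr e) lerD//.
    by rewrite -ler_pdivlMr// -mulrA -invfM.
  rewrite mulrA ler_pdivrMr// mulrA divfK// mulrC ler_wpM2l ?(ltW e0)//.
  by rewrite lerDl ler01.
Qed.

Lemma avg_sq_lty u : (\esum_(K in [set: int]) (`|coef u K| ^+ 2)%:E < +oo)%E.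
Proof.
apply: le_lt_trans (ltry (`|u| * `|u|)).
apply: ge_ereal_sup => _ /= [A [finA _] <-].
rewrite fsbig_finite// sumEFin lee_fin.
have us := finmap.fset_uniq (fset_set A).
apply: (@le_trans _ _
  (\sum_(K <- finmap.enum_fset (fset_set A)) `|u| * `|coef u K|)).
  apply: ler_sum => K _; rewrite expr2 ler_wpM2r//.
  exact: norm_coef_le_norm.
by rewrite -mulr_sumr ler_wpM2l//; exact: sum_norm_coef_le.
Qed.

Lemma coef_nonlocal u K : coef (nonlocal u) K =
  (2 * avg_sq u) *: coef u K - `|coef u K| ^+ 2 *: coef u K.
Proof.
rewrite /nonlocal Hper_coefD Hper_coefN Hper_coefZ coef_Finv//.
apply: (@finite_energy_coef _ L _ C _ (`|u| ^+ 2 *: u)) => J.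
rewrite Hper_coefZ !RcomplexZ_norm !(ger0_norm (sqr_ge0 _)) ler_wpM2r//.
rewrite lerXn2r ?nnegrE//.
exact: norm_coef_le_norm.
Qed.

Lemma tauP_gt0 : 0 < tauP.
Proof. by rewrite divr_gt0 ?exprn_gt0 ?mulr_gt0 ?pi_gt0. Qed.

Lemma dist_duhamel_integral_trunc u (I : H) (N : nat) :
  is_bochner lebesgue_measure `[0, tauP]%classic (duhamel u tauP) I ->
  `|I - tauP *: ((2 * \sum_(K <- zr N) `|coef u K| ^+ 2) *: trunc (zr N) u -
    \sum_(K <- zr N) mono K (`|coef u K| ^+ 2 *: coef u K))| <=
  tauP * (3 * `|u| ^+ 2 * `|trunc (zr N) u - u|).
Proof.
move=> uI; have t0 := ltW tauP_gt0.
have uI' := is_bochner_riemann t0 (unif_cont_duhamel u tauP) uI.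
have [n0 n0P] := riemann_sum_trunc L_gt0 C_large u N.
set X := tauP *: _; have vX :
    riemann_sum (duhamel (trunc (zr N) u) tauP) tauP n @[n --> \oo] --> X.
  by apply: cvg_near_cst; exists n0 => // n /= /n0P ->.
apply: (cvg_dist_le uI' vX) => n.
apply: le_trans (riemann_sum_dist (M := `|u| ^+ 3) n t0
  (e := 3 * `|u| ^+ 2 * `|trunc (zr N) u - u|) _ _) _.
- move=> r _; rewrite distrC; apply: dist_duhamel => //.
  by apply: norm_trunc_le; exact: zr_uniq.
- by move=> s; exact: norm_duhamel.
- by rewrite subrr normr0 mul0r add0r.
Qed.

Lemma duhamel_integral_nonlocal u (I : H) :
  is_bochner lebesgue_measure `[0, tauP]%classic (duhamel u tauP) I ->
  I = tauP *: nonlocal u.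
Proof.
move=> uI; have t0 := tauP_gt0.
apply: coef_inj => K; apply/eqP; rewrite -subr_eq0 -normr_le0.
apply/ler_addgt0Pl => e e0; rewrite addr0.
have e2 : 0 < e / 2 by rewrite divr_gt0.
have A1 : 0 < tauP * (3 * `|u| ^+ 2) + 1.
  by rewrite ltr_wpDl// mulr_ge0 ?(ltW t0)// mulr_ge0// sqr_ge0.
have t2 : 0 < tauP * 2 by rewrite mulr_gt0.
have u1 : 0 < `|u| + 1 by rewrite ltr_wpDl.
have B1 : 0 < tauP * 2 * (`|u| + 1) by rewrite mulr_gt0.
have /cvg_seqP/(_ _ (divr_gt0 e2 A1))[N1 uN1] := @trunc_cvg R L l C u.
have sq0 J : 0 <= `|coef u J| ^+ 2 by exact: sqr_ge0.
have [N2 uN2] := esum_zr_le sq0 (avg_sq_lty u) (divr_gt0 e2 B1).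
pose N := maxn (absz K) (maxn N1 N2).
have {uN1}uN1 : `|trunc (zr N) u - u| <= e / 2 / (tauP * (3 * `|u| ^+ 2) + 1).
  by apply: uN1; rewrite /N maxnCA leq_maxl.
have {}uN2 := uN2 N (leq_trans (leq_maxr _ _) (leq_maxr _ _)).
have uN3 := sum_le_esum sq0 (avg_sq_lty u) (zr_uniq N).
have IX := dist_duhamel_integral_trunc N uI.
set A := \sum_(J <- zr N) `|coef u J| ^+ 2 in uN2 uN3 IX.
set X := tauP *: _ in IX.
have KN : K \in zr N by rewrite mem_zr leq_maxl.
have XE : coef X K =
    tauP *: ((2 * A) *: coef u K - `|coef u K| ^+ 2 *: coef u K).
  rewrite /X Hper_coefZ Hper_coefD Hper_coefN Hper_coefZ.
  rewrite coef_trunc ?zr_uniq// KN.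
  congr (_ *: (_ - _)); rewrite Hper_coef_sum (bigD1_seq K) ?zr_uniq//=.
  rewrite coef_mono eqxx big1 ?addr0// => J JK.
  by rewrite coef_mono eq_sym (negbTE JK).
have -> : coef I K - coef (tauP *: nonlocal u) K =
    coef (I - X) K + (tauP * (2 * (A - avg_sq u))) *: coef u K.
  rewrite [coef (I - X) K]Hper_coefD Hper_coefN XE Hper_coefZ coef_nonlocal.
  have -> : (tauP * (2 * (A - avg_sq u))) *: coef u K = tauP *:
      (((2 * A) *: coef u K - `|coef u K| ^+ 2 *: coef u K) -
       ((2 * avg_sq u) *: coef u K - `|coef u K| ^+ 2 *: coef u K)).
    by rewrite -scalerA mulrBr scalerBl opprB addrA subrK.
  by rewrite [in RHS](scalerBr tauP (_ - _) (_ - _)) subrKA.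
apply: le_trans (ler_normD _ _) _; rewrite [leRHS](splitr e) lerD//.
  apply: le_trans (norm_coef_le_norm L_gt0 C_large _ _) _; apply: le_trans IX _.
  apply: (@le_trans _ _ (tauP * (3 * `|u| ^+ 2) *
    (e / 2 / (tauP * (3 * `|u| ^+ 2) + 1)))).
    by rewrite mulrA ler_wpM2l// mulr_ge0 ?(ltW t0)// mulr_ge0// sqr_ge0.
  rewrite mulrA ler_pdivrMr// mulrC ler_wpM2l ?(ltW e2)//.
  by rewrite lerDl ler01.
rewrite RcomplexZ_norm mulrA normrM (gtr0_norm t2).
have dA : `|A - avg_sq u| <= e / 2 / (tauP * 2 * (`|u| + 1)).
  by rewrite distrC ger0_norm ?subr_ge0// lerBlDl -lerBlDr.
apply: (@le_trans _ _
  (tauP * 2 * (e / 2 / (tauP * 2 * (`|u| + 1))) * (`|u| + 1))).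
  apply: ler_pM => //; first by rewrite mulr_ge0 ?(ltW t2).
    by rewrite ler_wpM2l ?(ltW t2).
  by apply: le_trans (norm_coef_le_norm L_gt0 C_large _ _) _; rewrite lerDl.
by rewrite mulrAC mulrC divfK// gt_eqF.
Qed.

End duhamel_integral.

(** * Mild solutions *)

Section mild_solutions.
Context (R : realType) (L l : R) (C : {posnum R}).
Local Notation H := (Hper L l C).

Lemma is_bochner_bounded_extension (E B : R -> H -> H) (t c : R)
    (f g : R -> H) (I : H) :
  bounded_extension2 E B -> c != 0 ->
  (forall s, 0 <= s <= t -> g s = c *: f s) ->
  is_bochner lebesgue_measure `[0, t]%classic (fun s => B (t - s) (f s)) I ->
  is_bochner lebesgue_measure `[0, t]%classic
    (fun s => B (t - s) (g s)) (c *: I).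
Proof.
move=> B_ext c0 gf.
apply: (is_bochner_scale_ae (measurable_segment t)
  (lebesgue_measure_segment_lty t) (N := [set t])) => //.
- exact: lebesgue_measure_set1.
- move=> s /=; rewrite in_itv /= => st /eqP st'; rewrite gf//.
  have ts : 0 < t - s.
    by rewrite subr_gt0 lt_neqAle st' /=; case/andP: st.
  have [[B_lin _] _] := B_ext _ ts.
  have B0 : B (t - s) 0 = 0.
    have := B_lin 1 0 0; rewrite !scale1r addr0 => /eqP.
    by rewrite -[X in X == _]addr0 (inj_eq (addrI _)) eq_sym => /eqP.
  by have := B_lin c (f s) 0; rewrite B0 !addr0.
Qed.

Lemma within_continuous_dist (V : normedModType R) (T : R) (a : R -> V)
    (t e : R) :
  {within `[0, T], continuous a} -> 0 <= t <= T -> 0 < e ->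
  exists2 del, 0 < del & forall s, 0 <= s <= T -> `|s - t| <= del ->
    `|a s - a t| <= e.
Proof.
move=> /subspace_continuousP ac tT e0.
have /ac/cvgrPdist_le/(_ _ e0)[d /= d0 ad] : `[0, T]%classic t.
  by rewrite /= in_itv.
exists (d / 2) => [|s sT st]; first by rewrite divr_gt0.
rewrite distrC; apply: ad; last by rewrite /= in_itv.
by rewrite /= distrC; apply: le_lt_trans st _; lra.
Qed.

Lemma within_continuous2P (V : normedModType R) (T X : R) (f : R -> R -> V) :
  (forall t x e, 0 <= t <= T -> 0 <= x <= X -> 0 < e ->
    exists2 del, 0 < del & forall t' x', 0 <= t' <= T -> 0 <= x' <= X ->
      `|t' - t| <= del -> `|x' - x| <= del -> `|f t' x' - f t x| <= e) ->
  {within `[0, T] `*` `[0, X], continuous (fun p : R * R => f p.1 p.2)}.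
Proof.
move=> fc; apply/subspace_continuousP => -[t x] [/= tT xX].
rewrite !in_itv /= in tT xX.
apply/cvgrPdist_le => e e0; have [d d0 fd] := fc t x e tT xX e0.
exists (ball t d, ball x d); first by split; exact: nbhsx_ballx.
move=> [t' x'] [/= tt' xx'] [/=]; rewrite !in_itv /= => tT' xX'.
by rewrite distrC; apply: fd => //; rewrite distrC ltW.
Qed.

Lemma within_continuous_pair (U V W : topologicalType) (A : set U)
    (f : U -> V) (g : U -> W) :
  {within A, continuous f} -> {within A, continuous g} ->
  {within A, continuous (fun x => (f x, g x))}.
Proof. by move=> fc gc x; apply: cvg_pair; [exact: fc|exact: gc]. Qed.

End mild_solutions.

Theorem corollary3p4 (R : realType) (L T mu l tauP : R) (C : {posnum R})
    (L_gt0 : 0 < L) (T_gt0 : 0 < T) (mu_gt0 : 0 < mu) (l_gt : 1 / 2 < l)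
    (tauPE : tauP = L ^+ 2 / (2 * pi))
    (C_large : admissible_norm L l C)
    (E B2 : R -> Hper L l C -> Hper L l C)
    (E_gen : generates (Lop mu) (sobolev 4) E)
    (B2_ext : bounded_extension2 E B2)
    (a : R -> Hper L l C) (a_cont : {within `[0, T], continuous a}) :
  mild_nonlocal T E B2 a <->
  exists v w : R -> R -> Hper L l C,
    {within `[0, T] `*` `[0, tauP],
      continuous (fun p : R * R => (v p.1 p.2, w p.1 p.2))} /\
    mild_extended T tauP E B2 a v w.
Proof.
have tauP_gt0 : 0 < tauP by rewrite tauPE; exact: tauP_gt0.
have tauP_neq0 : tauP != 0 by rewrite gt_eqF.
have sub_itv t s : t \in `[0, T] -> 0 <= s <= t -> s \in `[0, T].
  rewrite !in_itv /= => /andP[_ tT] /andP[-> st]; exact: le_trans st tT.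
split=> [[_ mild_a]|[v [w [vw_cont mild_vw]]]]; last first.
  split=> // t tT; have [[I BI aE] _] := mild_vw t tT.
  exists (tauP^-1 *: I); last first.
    rewrite aE scalerA; congr (_ + _ *: _); field.
    exact: tauP_neq0.
  apply: (is_bochner_bounded_extension B2_ext _ _ BI).
    by rewrite invr_eq0.
  move=> s st; have sT := sub_itv _ _ tT st.
  have tauP_itv : tauP \in `[0, tauP] by rewrite in_itv /= ltW//=.
  have [_ /(_ tauP tauP_itv)[_ wI]] := mild_vw s sT.
  rewrite (@duhamel_integral_nonlocal _ _ _ _ L_gt0 C_large (a s) (w s tauP)).
    by rewrite -tauPE scalerA mulVf// scale1r.
  rewrite -tauPE; apply: eq_is_bochner wI => [||x /=].
  - exact: measurable_segment.
  - exact: lebesgue_measure_segment_lty.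
  - by rewrite in_itv /= => xP; have [_ /(_ x xP)[-> _]] := mild_vw s sT.
pose v t tau := schroedinger tau (a t).
pose w t tau := xget 0 [set I : Hper L l C |
  is_bochner lebesgue_measure `[0, tau]%classic (duhamel (a t) tau) I].
have wP t tau : 0 <= tau -> is_bochner lebesgue_measure `[0, tau]%classic
    (duhamel (a t) tau) (w t tau).
  by move=> tau0; apply: (xgetPex 0); exact: duhamel_integral_exists.
exists v, w; split.
  apply: within_continuous_pair;
      apply: within_continuous2P => t tau e tT tauT e0.
    have e2 : 0 < e / 2 by rewrite divr_gt0.
    have [d1 d10 ad] := within_continuous_dist a_cont tT e2.
    have [d2 d20 Sd] := schroedinger_cvg0 (a t) e2.
    exists (Num.min d1 d2); first by rewrite lt_min d10.
    move=> t' tau' tT' _; rewrite !le_min => /andP[td _] /andP[_ taud].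
    apply: le_trans (ler_distD (schroedinger tau' (a t)) _ _) _.
    rewrite [leRHS](splitr e); apply: lerD.
      rewrite -schroedingerN -schroedingerD norm_schroedinger; exact: ad.
    by rewrite dist_schroedinger; exact: Sd.
  have /andP[tau0 _] := tauT.
  have [d d0 wd] := duhamel_integral_cont L_gt0 C_large (a t) tau0 e0.
  have [d1 d10 ad] := within_continuous_dist a_cont tT d0.
  exists (Num.min d1 d); first by rewrite lt_min d10.
  move=> t' tau' tT' /andP[tau0' _].
  rewrite !le_min => /andP[td _] /andP[_ taud].
  by apply: (wd (a t') tau') => //; [exact: ad|exact: wP|exact: wP].
move=> t tT; split; last first.
  move=> tau; rewrite in_itv /= => /andP[tau0 _]; split => //.
  exact: wP.
have [I BI aE] := mild_a t tT; exists (tauP *: I); last first.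
  rewrite aE scalerA; congr (_ + _ *: _); field.
  exact: tauP_neq0.
apply: (is_bochner_bounded_extension B2_ext tauP_neq0 _ BI) => s _.
have := wP s tauP (ltW tauP_gt0); rewrite tauPE.
exact: duhamel_integral_nonlocal.
Qed.
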